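(* Let $\mathcal{W}=\mathcal{I}\times\mathbb{R}$ be a vertical strip of $\mathbb{R}^2$, where $\mathcal{I}$ is an open interval containing the origin. Assume that the functions $f$ and $g$ are of class $\mathcal{C}^1$, that $g$ only vanishes at the origin, and that $f+2(f/g)'G$ does not change sign on $\mathcal{I}$, vanishing only at $x=0$, where $G(x)=\int_0^xg(z)\,dz$. Then the system $$\dot x=y,\qquad \dot y=-f(x)y-g(x)$$ has at most one periodic orbit which entirely lies in $\mathcal{W}$, and when it exists it is a hyperbolic limit cycle.
   Context: The quantities $G/g$ and $(f/g)'G$ are understood as being well-defined at $x=0$ (extended there by continuity). A limit cycle is an isolated periodic orbit; a periodic orbit $(x(t),y(t))$ of period $T$ of a planar vector field $X$ is hyperbolic if $\int_0^T\operatorname{div}X(x(t),y(t))\,dt\ne0$. *)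

(* Defs.v *)
From Stdlib Require Import Reals.
From Coquelicot Require Import Coquelicot.
Open Scope R_scope.

Definition plane_field := R * R -> R * R.

Definition divergence (X : plane_field) (p : R * R) : R :=
  Derive (fun u => fst (X (u, snd p))) (fst p)
  + Derive (fun v => snd (X (fst p, v))) (snd p).

Definition is_solution (X : plane_field) (gamma : R -> R * R) : Prop :=
  forall t : R,
    is_derive (fun s => fst (gamma s)) t (fst (X (gamma t))) /\
    is_derive (fun s => snd (gamma s)) t (snd (X (gamma t))).

(** [gamma] is a non-constant solution with image [Gamma], and [T > 0] is a
    period of it, not necessarily the minimal one. *)
Definition periodic_parametrization (X : plane_field) (Gamma : R * R -> Prop)
    (gamma : R -> R * R) (T : R) : Prop :=
  is_solution X gamma /\
  0 < T /\
  (forall t, gamma (t + T) = gamma t) /\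
  (exists t, gamma t <> gamma 0) /\
  (forall p, Gamma p <-> exists t, gamma t = p).

Definition periodic_orbit (X : plane_field) (Gamma : R * R -> Prop) : Prop :=
  exists (gamma : R -> R * R) (T : R), periodic_parametrization X Gamma gamma T.

Definition limit_cycle (X : plane_field) (Gamma : R * R -> Prop) : Prop :=
  periodic_orbit X Gamma /\
  exists U : R * R -> Prop,
    open U /\
    (forall p, Gamma p -> U p) /\
    (forall Gamma' : R * R -> Prop,
       periodic_orbit X Gamma' -> (forall p, Gamma' p -> U p) ->
       forall p, Gamma' p <-> Gamma p).

(** The integral over a multiple of the minimal period is a multiple of the
    integral over the minimal period, and a time shift does not change it, so
    the condition does not depend on the parametrization. *)
Definition hyperbolic (X : plane_field) (Gamma : R * R -> Prop) : Prop :=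
  forall (gamma : R -> R * R) (T : R),
    periodic_parametrization X Gamma gamma T ->
    RInt (fun t => divergence X (gamma t)) 0 T <> 0.

(** Endpoints in [Rbar], so that the interval may be unbounded. *)
Definition Rbar_interval (a b : Rbar) (x : R) : Prop :=
  Rbar_lt a x /\ Rbar_lt x b.

Definition strip (a b : Rbar) (p : R * R) : Prop := Rbar_interval a b (fst p).

Definition C1_on (D : R -> Prop) (f : R -> R) : Prop :=
  forall x, D x -> ex_derive f x /\ continuous (Derive f) x.

Definition lienard (f g : R -> R) : plane_field :=
  fun p => (snd p, - f (fst p) * snd p - g (fst p)).

Definition int_from_0 (g : R -> R) (x : R) : R := RInt g 0 x.

(** The value of [u] at [0] is ignored and replaced by its limit there; this
    is the continuous extension only when [ex_finite_lim u 0] holds. *)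
Definition extend_at_0 (u : R -> R) (x : R) : R :=
  if Req_EM_T x 0 then real (Lim u 0) else u x.

Definition G_over_g (g : R -> R) (x : R) : R := int_from_0 g x / g x.

Definition fg'G (f g : R -> R) (x : R) : R :=
  Derive (fun z => f z / g z) x * int_from_0 g x.

(* Main.v *)
(* With [V(x,y) = y^2 + 2 (f G / g) y + 2 G] and [phi = f + 2 (f/g)' G], the derivative of [V]
   along the flow is [- f V + phi y^2]. Hence, for [phi >= 0] (reverse time otherwise),
   [V exp (int f)] grows strictly along a periodic orbit while [V] is periodic: [V] never
   vanishes on the orbit and the integral of the divergence [- f] over a period is not [0].
   Moreover the orbit surrounds the origin and [V > 0] on it, since [V = 2 G > 0] where [x] is
   maximal.

   For uniqueness put [u = sqrt (2 G)] and [F = f u / g], so that [F' = phi / u]. On a half-turn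
   in [x > 0] the slope [v = - y / u] increases from [- oo] to [+ oo], because
   [v' = g V / u^3], and [d (ln u) / d v = - v / (v^2 - F v + 1)]. As [F] increases with [u],
   two half-turns compared at equal slope approach each other in ratio; the same holds for
   [x < 0] by rotation. So the return map of the positive [y]-axis strictly contracts
   logarithmic distances, and all crossings by periodic orbits coincide. *)

Require Import Defs.
From Stdlib Require Import Reals ZArith Lra Lia Classical ClassicalEpsilon.
From Coquelicot Require Import Coquelicot.
Open Scope R_scope.

(** The form of [V] is forced. For [V = y^2 + A y + 2 G] the flow gives
    [V' = (A' - 2 f) y^2 - A f y - A g]; the term free of [y] matches that of [- f V] exactly when
    [A g = 2 f G], and then [A' - f = phi].

    The slope is a good parameter because every half-turn sweeps all of R, so half-turns of
    different orbits share one domain whatever their durations. Both ends are singular ([u] tends to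
    0, [v] to infinity), yet [ln u + ln |v| = ln |y|] stays finite there; hence the difference of
    the two [ln u] tends to the logarithmic distance of the crossings.

    The return map enters only through successive crossings of the given periodic solutions. A
    priori a solution may cross the positive axis at several heights within a period, so the
    contraction is applied to a pair of crossings at greatest logarithmic distance, which
    compactness provides, and to the pair one turn earlier. Equality of crossings then spreads to
    whole half-turns by the same monotone quantity. *)

(** * Monotonicity and inverse functions *)

Lemma is_derive_continuity_pt (h : R -> R) (t l : R) :
  is_derive h t l -> continuity_pt h t.
Proof.
  intros H. apply continuity_pt_filterlim.
  apply (ex_derive_continuous h). now exists l.
Qed.

Lemma derive_nonneg_le (h dh : R -> R) (p q : R) :
  p <= q ->
  (forall t, p < t < q -> is_derive h t (dh t)) ->
  (forall t, p <= t <= q -> continuity_pt h t) ->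
  (forall t, p <= t <= q -> 0 <= dh t) ->
  h p <= h q.
Proof.
  intros Hpq Hd Hc Hpos.
  destruct (MVT_gen h p q dh) as [c [Hc1 Hc2]].
  - rewrite Rmin_left, Rmax_right by lra. exact Hd.
  - rewrite Rmin_left, Rmax_right by lra. exact Hc.
  - rewrite Rmin_left, Rmax_right in Hc1 by lra.
    specialize (Hpos c Hc1). nra.
Qed.

Lemma derive_pos_lt (h dh : R -> R) (p q : R) :
  p < q ->
  (forall t, p <= t <= q -> is_derive h t (dh t)) ->
  (forall t, p <= t <= q -> 0 < dh t) ->
  h p < h q.
Proof.
  intros Hpq Hd Hpos.
  destruct (MVT_gen h p q dh) as [c [Hc1 Hc2]].
  - rewrite Rmin_left, Rmax_right by lra. intros t Ht. apply Hd. lra.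
  - rewrite Rmin_left, Rmax_right by lra. intros t Ht.
    eapply is_derive_continuity_pt, Hd, Ht.
  - rewrite Rmin_left, Rmax_right in Hc1 by lra.
    specialize (Hpos c Hc1). nra.
Qed.

(** Unboundedness in both directions makes the image all of R, so the inverse [k] is total: the
    intermediate value theorem gives preimages, choice selects them, and strict monotonicity makes
    [k] two-sided. *)
Lemma inverse_of_increasing (h dh : R -> R) (s e : R) :
  (forall t, s < t < e -> is_derive h t (dh t)) ->
  (forall t, s < t < e -> 0 < dh t) ->
  (forall M, exists t, s < t < e /\ M < h t) ->
  (forall M, exists t, s < t < e /\ h t < M) ->
  exists k : R -> R,
    (forall v, s < k v < e /\ h (k v) = v /\ is_derive k v (/ dh (k v))) /\
    (forall t, s < t < e -> k (h t) = t).
Proof.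
  intros Hd Hpos Hup Hdown.
  assert (Hinc : forall t t', s < t -> t < t' -> t' < e -> h t < h t').
  { intros t t' H1 H2 H3. apply (derive_pos_lt h dh); auto.
    - intros r Hr. apply Hd. lra.
    - intros r Hr. apply Hpos. lra. }
  assert (Hex : forall v, exists t, s < t < e /\ h t = v).
  { intros v. destruct (Hup v) as [q [Hq1 Hq2]]. destruct (Hdown v) as [p [Hp1 Hp2]].
    assert (Hpq : p < q).
    { destruct (Rtotal_order p q) as [H|[H|H]]; auto.
      - subst; lra.
      - assert (h q < h p) by (apply Hinc; lra). lra. }
    destruct (Ranalysis5.IVT_interv (fun t => h t - v) p q) as [z [Hz1 Hz2]]; try lra.
    - intros t Ht. apply continuity_pt_minus.
      + apply (is_derive_continuity_pt h t (dh t)). apply Hd. lra.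
      + apply continuity_pt_const. now intros ? ?.
    - exists z. lra. }
  exists (fun v => proj1_sig (constructive_indefinite_description _ (Hex v))).
  set (k := fun v => proj1_sig (constructive_indefinite_description _ (Hex v))).
  assert (Hk : forall v, s < k v < e /\ h (k v) = v).
  { intros v. unfold k. apply (proj2_sig (constructive_indefinite_description _ (Hex v))). }
  change ((forall v, s < k v < e /\ h (k v) = v /\ is_derive k v (/ dh (k v))) /\
    (forall t, s < t < e -> k (h t) = t)).
  assert (Hkh : forall t, s < t < e -> k (h t) = t).
  { intros t Ht. destruct (Hk (h t)) as [H1 H2].
    destruct (Rtotal_order (k (h t)) t) as [H|[H|H]]; auto.
    - assert (h (k (h t)) < h t) by (apply Hinc; lra). lra.
    - assert (h t < h (k (h t))) by (apply Hinc; lra). lra. }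
  assert (Hkinc : forall v v', v < v' -> k v < k v').
  { intros v v' Hv. destruct (Hk v) as [H1 H2]. destruct (Hk v') as [H3 H4].
    destruct (Rlt_or_le (k v) (k v')) as [H|[H|H]]; auto.
    - assert (h (k v') < h (k v)) by (apply Hinc; lra). lra.
    - rewrite H in H4. lra. }
  split; [|exact Hkh].
  intros v. destruct (Hk v) as [H1 H2]. split; [exact H1|split; [exact H2|]].
  (* Midpoints give a compact interval around [k v] inside [(s, e)], where the inverse function
     lemmas apply. *)
  set (p := (s + k v) / 2). set (q := (k v + e) / 2).
  assert (Hp : s < p < k v) by (unfold p; lra).
  assert (Hq : k v < q < e) by (unfold q; lra).
  assert (Hlub : h p < h q) by (apply Hinc; lra).
  assert (Hv : h p < v < h q).
  { rewrite <- H2. split; apply Hinc; lra. }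
  assert (Hcont : continuity_pt k v).
  { apply (Ranalysis5.continuity_pt_recip_interv h k p q); try lra.
    - intros t t' Ht Htt' Ht'. apply Hinc; lra.
    - intros t _ _. apply Hk.
    - intros t Ht1 Ht2. rewrite <- (Hkh p), <- (Hkh q) by lra.
      destruct Ht1 as [Ht1|Ht1]; destruct Ht2 as [Ht2|Ht2]; subst;
        try (apply Hkinc in Ht1); try (apply Hkinc in Ht2); lra.
    - intros t Ht. apply (is_derive_continuity_pt h t (dh t)). apply Hd. lra. }
  apply is_derive_Reals.
  assert (Prf : forall t, k (h p) <= t <= k (h q) -> derivable_pt h t).
  { rewrite (Hkh p), (Hkh q) by lra. intros t Ht. exists (dh t).
    apply is_derive_Reals, Hd. lra. }
  assert (Hin : k (h p) <= k v <= k (h q)).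
  { rewrite (Hkh p), (Hkh q) by lra. lra. }
  assert (HD : derive_pt h (k v) (Prf (k v) Hin) = dh (k v)).
  { rewrite Derive_Reals. apply is_derive_unique. apply Hd. exact H1. }
  assert (Hdpos := Hpos (k v) H1).
  assert (Hfin := Ranalysis5.derivable_pt_lim_recip_interv h k (h p) (h q) v Prf Hcont Hlub Hv Hin
    (fun t _ => proj2 (Hk t))).
  rewrite HD in Hfin. replace (/ dh (k v)) with (1 / dh (k v)) by (field; lra).
  apply Hfin. lra.
Qed.

Lemma is_derive_eq (h : R -> R) (t l l' : R) :
  is_derive h t l -> l = l' -> is_derive h t l'.
Proof. intros H <-. exact H. Qed.

(** * Half-turns in slope coordinates *)

(** Abstracts one side of the [y]-axis, so that one argument serves [x > 0] and, after rotation,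
    [x < 0]. The last field says that [F = f u / g] is strictly increasing as a function of [u]. *)
Record half_strip (J : R -> Prop) (f g u : R -> R) : Prop := {
  hs_u_pos : forall x, J x -> 0 < u x;
  hs_g_pos : forall x, J x -> 0 < g x;
  hs_u_derive : forall x, J x -> is_derive u x (g x / u x);
  hs_u_cont : continuity_pt u 0;
  hs_u_zero : u 0 = 0;
  hs_u_inj : forall x x', J x -> J x' -> u x = u x' -> x = x';
  hs_slope_incr : forall x x', J x -> J x' -> u x < u x' ->
    f x * u x / g x < f x' * u x' / g x'
}.

(** The field [ht_V] is [V > 0] rewritten with [u^2 = 2 G]. *)
Record half_turn (J : R -> Prop) (f g u x y : R -> R) (s e : R) : Prop := {
  ht_lt : s < e;
  ht_xs : x s = 0;
  ht_xe : x e = 0;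
  ht_ys : 0 < y s;
  ht_ye : y e < 0;
  ht_in : forall t, s < t < e -> J (x t);
  ht_dx : forall t, is_derive x t (y t);
  ht_dy : forall t, is_derive y t (- f (x t) * y t - g (x t));
  ht_V : forall t, s < t < e ->
    0 < y t ^ 2 + f (x t) * u (x t) / g (x t) * u (x t) * y t + u (x t) ^ 2
}.

Lemma ratio_large_near_zero (x y u : R -> R) (s : R) (M : R) :
  continuity_pt (fun t => u (x t)) s -> u (x s) = 0 ->
  continuity_pt y s -> 0 < y s ->
  exists d, 0 < d /\ forall t, Rabs (t - s) < d -> 0 < u (x t) -> M < y t / u (x t).
Proof.
  intros Hu Hu0 Hy Hys.
  (* A positive bound in place of [M] allows the neighbourhood to be chosen by [u < y s / (2 K)]. *)
  set (K := Rmax M 1).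
  assert (HK : 0 < K) by (unfold K; generalize (Rmax_r M 1); lra).
  assert (HMK : M <= K) by apply Rmax_l.
  assert (He1 : 0 < y s / 2) by lra.
  assert (He2 : 0 < y s / 2 / K) by (apply Rdiv_lt_0_compat; lra).
  apply continuity_pt_locally with (eps := mkposreal _ He1) in Hy.
  apply continuity_pt_locally with (eps := mkposreal _ He2) in Hu.
  destruct Hy as [d1 Hd1]. destruct Hu as [d2 Hd2]. simpl in Hd1, Hd2.
  exists (Rmin d1 d2). split; [apply Rmin_pos; apply cond_pos|].
  intros t Ht Hpos.
  assert (Ht1 : Rabs (t - s) < d1) by (eapply Rlt_le_trans; [exact Ht|apply Rmin_l]).
  assert (Ht2 : Rabs (t - s) < d2) by (eapply Rlt_le_trans; [exact Ht|apply Rmin_r]).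
  specialize (Hd1 t Ht1). specialize (Hd2 t Ht2).
  rewrite Hu0 in Hd2. rewrite Rminus_0_r, Rabs_pos_eq in Hd2 by lra.
  apply Rabs_lt_between in Hd1.
  apply Rle_lt_trans with K; [exact HMK|].
  apply Rmult_lt_reg_r with (u (x t)); [exact Hpos|].
  replace (y t / u (x t) * u (x t)) with (y t) by (field; lra).
  assert (u (x t) * K < y s / 2).
  { apply Rmult_lt_reg_r with (/ K); [now apply Rinv_0_lt_compat|].
    replace (u (x t) * K * / K) with (u (x t)) by (field; lra). exact Hd2. }
  lra.
Qed.

(** [xi v] is the abscissa at the moment when the slope equals [v]. Since [y = - v u], the sums in
    the two limits are [ln y] and [ln (- y)] at that moment, so they converge although each summand
    diverges. The last two clauses translate between points of the orbit and slopes. *)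
Lemma half_turn_profile (J : R -> Prop) (f g u x y : R -> R) (s e : R) :
  half_strip J f g u -> half_turn J f g u x y s e ->
  exists xi : R -> R,
    (forall v, J (xi v) /\ 0 < v ^ 2 - f (xi v) * u (xi v) / g (xi v) * v + 1 /\
       is_derive (fun v => ln (u (xi v))) v
         (- v / (v ^ 2 - f (xi v) * u (xi v) / g (xi v) * v + 1))) /\
    is_lim (fun v => ln (u (xi v)) + ln (- v)) m_infty (ln (y s)) /\
    is_lim (fun v => ln (u (xi v)) + ln v) p_infty (ln (- y e)) /\
    (forall v, exists t, x t = xi v /\ y t = - v * u (xi v)) /\
    (forall t, s < t < e -> exists v, x t = xi v /\ y t = - v * u (xi v)).
Proof.
  intros [Hup Hgp Hud Huc Hu0 _ _] [Hlt Hxs Hxe Hys Hye Hin Hdx Hdy HV].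
  set (h := fun t => - y t / u (x t)).
  set (dh := fun t => g (x t) * (y t ^ 2 + f (x t) * u (x t) / g (x t) * u (x t) * y t + u (x t) ^ 2)
                    / u (x t) ^ 3).
  assert (Hdu : forall t, s < t < e -> is_derive (fun t => u (x t)) t (g (x t) / u (x t) * y t)).
  { intros t Ht. rewrite Rmult_comm.
    apply (is_derive_comp u x); [apply Hud, Hin, Ht|apply Hdx]. }
  assert (Hcu : forall t, x t = 0 -> continuity_pt (fun t => u (x t)) t).
  { intros t Ht. apply (continuity_pt_comp x u).
    - eapply is_derive_continuity_pt, Hdx.
    - rewrite Ht. exact Huc. }
  assert (Hdh : forall t, s < t < e -> is_derive h t (dh t)).
  { intros t Ht. assert (HJ := Hin t Ht). assert (H1 := Hup _ HJ). assert (H2 := Hgp _ HJ).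
    replace (dh t) with ((- (- f (x t) * y t - g (x t)) * u (x t) - - y t * (g (x t) / u (x t) * y t)) / u (x t) ^ 2)
      by (unfold dh; field; lra).
    apply (is_derive_div (fun t => - y t) (fun t => u (x t))).
    - apply (is_derive_opp y). apply Hdy.
    - apply Hdu, Ht.
    - lra. }
  assert (Hdhp : forall t, s < t < e -> 0 < dh t).
  { intros t Ht. assert (HJ := Hin t Ht). assert (H1 := Hup _ HJ). assert (H2 := Hgp _ HJ).
    unfold dh. apply Rdiv_lt_0_compat; [apply Rmult_lt_0_compat; auto|apply pow_lt; auto]. }
  destruct (inverse_of_increasing h dh s e Hdh Hdhp) as [k [Hk Hkh]].
  { intros M.
    destruct (ratio_large_near_zero x (fun t => - y t) u e M) as [d [Hd1 Hd2]].
    - apply Hcu, Hxe.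
    - now rewrite Hxe.
    - apply (continuity_pt_opp y). eapply is_derive_continuity_pt, Hdy.
    - lra.
    - set (t := e - Rmin (d / 2) ((e - s) / 2)).
      assert (Hm : 0 < Rmin (d / 2) ((e - s) / 2)) by (apply Rmin_pos; lra).
      assert (Hm1 := Rmin_l (d / 2) ((e - s) / 2)). assert (Hm2 := Rmin_r (d / 2) ((e - s) / 2)).
      assert (Ht : s < t < e) by (unfold t; lra).
      exists t. split; [exact Ht|]. apply Hd2.
      + apply Rabs_lt_between. unfold t. lra.
      + apply Hup, Hin, Ht. }
  { intros M.
    destruct (ratio_large_near_zero x y u s (- M)) as [d [Hd1 Hd2]].
    - apply Hcu, Hxs.
    - now rewrite Hxs.
    - eapply is_derive_continuity_pt, Hdy.
    - lra.
    - set (t := s + Rmin (d / 2) ((e - s) / 2)).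
      assert (Hm : 0 < Rmin (d / 2) ((e - s) / 2)) by (apply Rmin_pos; lra).
      assert (Hm1 := Rmin_l (d / 2) ((e - s) / 2)). assert (Hm2 := Rmin_r (d / 2) ((e - s) / 2)).
      assert (Ht : s < t < e) by (unfold t; lra).
      exists t. split; [exact Ht|].
      assert (HM : - M < y t / u (x t)).
      { apply Hd2; [|apply Hup, Hin, Ht]. apply Rabs_lt_between. unfold t. lra. }
      unfold h, Rdiv in *. lra. }
  assert (Hhinc : forall t t', s < t -> t < t' -> t' < e -> h t < h t').
  { intros t t' H1 H2 H3. apply (derive_pos_lt h dh); auto.
    - intros r Hr. apply Hdh. lra.
    - intros r Hr. apply Hdhp. lra. }
  assert (Hyk : forall v, y (k v) = - v * u (x (k v))).
  { intros v. destruct (Hk v) as [H1 [H2 _]]. unfold h in H2.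
    assert (Hu := Hup _ (Hin _ H1)). rewrite <- H2 at 2. field. lra. }
  assert (Hden : forall v,
    y (k v) ^ 2 + f (x (k v)) * u (x (k v)) / g (x (k v)) * u (x (k v)) * y (k v) + u (x (k v)) ^ 2
    = u (x (k v)) ^ 2 * (v ^ 2 - f (x (k v)) * u (x (k v)) / g (x (k v)) * v + 1)).
  { intros v. rewrite Hyk. unfold Rdiv. ring. }
  exists (fun v => x (k v)). split; [intros v; split; [|split]|split; [|split; [|split]]].
  - apply Hin, Hk.
  - destruct (Hk v) as [H1 _]. assert (HVk := HV _ H1).
    rewrite Hden in HVk. assert (Hu := Hup _ (Hin _ H1)).
    apply Rmult_lt_reg_l with (u (x (k v)) ^ 2); [now apply pow_lt|lra].
  - destruct (Hk v) as [H1 [H2 H3]]. assert (HVk := HV _ H1).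
    assert (Hu := Hup _ (Hin _ H1)). assert (Hg := Hgp _ (Hin _ H1)).
    assert (Hd : is_derive (fun t => ln (u (x t))) (k v) (g (x (k v)) / u (x (k v)) * y (k v) * / u (x (k v)))).
    { apply (is_derive_comp ln (fun t => u (x t))); [now apply is_derive_ln|now apply Hdu]. }
    eapply is_derive_eq.
    + apply (is_derive_comp (fun t => ln (u (x t))) k); [exact Hd|exact H3].
    + unfold dh. unfold scal; simpl; unfold mult; simpl.
      assert (HD := Hden v). simpl in HD, HVk. rewrite HD in *. rewrite Hyk.
      assert (0 < v * (v * 1) - f (x (k v)) * u (x (k v)) / g (x (k v)) * v + 1).
      { apply Rmult_lt_reg_l with (u (x (k v)) ^ 2); [now apply pow_lt|simpl; lra]. }
      set (q := v * (v * 1) - f (x (k v)) * u (x (k v)) / g (x (k v)) * v + 1) in *.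
      field. repeat split; lra.
  - assert (Hc : continuity_pt (fun t => ln (y t)) s).
    { apply (continuity_pt_comp y ln); [eapply is_derive_continuity_pt, Hdy|].
      apply (is_derive_continuity_pt ln _ (/ y s)). now apply is_derive_ln. }
    apply is_lim_spec. intros eps.
    apply continuity_pt_locally with (eps := eps) in Hc. destruct Hc as [d Hd].
    set (t0 := s + Rmin (d / 2) ((e - s) / 2)).
    assert (Hdp := cond_pos d).
    assert (Hm : 0 < Rmin (d / 2) ((e - s) / 2)) by (apply Rmin_pos; lra).
    assert (Hm1 := Rmin_l (d / 2) ((e - s) / 2)). assert (Hm2 := Rmin_r (d / 2) ((e - s) / 2)).
    exists (Rmin 0 (h t0)). intros v Hv.
    assert (Hv1 := Rmin_l 0 (h t0)). assert (Hv2 := Rmin_r 0 (h t0)).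
    destruct (Hk v) as [H1 [H2 _]]. assert (Hu := Hup _ (Hin _ H1)).
    rewrite <- ln_mult by lra. rewrite Rmult_comm. rewrite <- Hyk.
    apply Hd. apply Rabs_lt_between. change (minus (k v) s) with (k v - s).
    (* The slope increases with time, so a slope below [h t0] is attained before [t0], hence close
       to [s]. *)
    assert (k v < t0).
    { apply Rnot_le_lt. intros [Hle|Heq].
      - assert (h t0 < h (k v)) by (apply Hhinc; unfold t0 in *; lra). lra.
      - rewrite Heq in *. lra. }
    unfold t0 in *. lra.
  - assert (Hc : continuity_pt (fun t => ln (- y t)) e).
    { apply (continuity_pt_comp (fun t => - y t) ln).
      - apply (continuity_pt_opp y). eapply is_derive_continuity_pt, Hdy.
      - apply (is_derive_continuity_pt ln _ (/ - y e)). apply is_derive_ln. lra. }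
    apply is_lim_spec. intros eps.
    apply continuity_pt_locally with (eps := eps) in Hc. destruct Hc as [d Hd].
    set (t0 := e - Rmin (d / 2) ((e - s) / 2)).
    assert (Hdp := cond_pos d).
    assert (Hm : 0 < Rmin (d / 2) ((e - s) / 2)) by (apply Rmin_pos; lra).
    assert (Hm1 := Rmin_l (d / 2) ((e - s) / 2)). assert (Hm2 := Rmin_r (d / 2) ((e - s) / 2)).
    exists (Rmax 0 (h t0)). intros v Hv.
    assert (Hv1 := Rmax_l 0 (h t0)). assert (Hv2 := Rmax_r 0 (h t0)).
    destruct (Hk v) as [H1 [H2 _]]. assert (Hu := Hup _ (Hin _ H1)).
    rewrite <- ln_mult by lra.
    replace (u (x (k v)) * v) with (- y (k v)) by (rewrite Hyk; ring).
    apply Hd. apply Rabs_lt_between. change (minus (k v) e) with (k v - e).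
    assert (t0 < k v).
    { apply Rnot_le_lt. intros [Hle|Heq].
      - assert (h (k v) < h t0) by (apply Hhinc; unfold t0 in *; lra). lra.
      - rewrite <- Heq in *. lra. }
    unfold t0 in *. lra.
  - intros v. exists (k v). auto.
  - intros t Ht. exists (h t). rewrite (Hkh t Ht). split; [reflexivity|].
    assert (Hu := Hup _ (Hin _ Ht)). unfold h. field. lra.
Qed.

(* At equal slope [v = - y / u], the difference [D = ln u1 - ln u2] satisfies
   [D' = v^2 (F2 - F1) / (positive)] with [F = f u / g] increasing in [u],
   so that [D^2] decreases in forward time. *)
Lemma half_turn_contracts (J : R -> Prop) (f g u x1 y1 x2 y2 : R -> R) (s1 e1 s2 e2 : R) :
  half_strip J f g u ->
  half_turn J f g u x1 y1 s1 e1 -> half_turn J f g u x2 y2 s2 e2 ->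
  let ds := ln (y1 s1) - ln (y2 s2) in
  let de := ln (- y1 e1) - ln (- y2 e2) in
  de ^ 2 <= ds ^ 2 /\ (ds <> 0 -> de ^ 2 < ds ^ 2) /\
  (ds = 0 -> forall t, s1 < t < e1 -> exists t', x1 t = x2 t' /\ y1 t = y2 t').
Proof.
  intros HS H1 H2 ds de.
  destruct (half_turn_profile _ _ _ _ _ _ _ _ HS H1) as [xi1 [HP1 [Hs1 [He1 [_ HB1]]]]].
  destruct (half_turn_profile _ _ _ _ _ _ _ _ HS H2) as [xi2 [HP2 [Hs2 [He2 [HA2 _]]]]].
  set (F := fun x => f x * u x / g x) in *.
  set (D := fun v => ln (u (xi1 v)) - ln (u (xi2 v))).
  set (dD := fun v => v ^ 2 * (F (xi2 v) - F (xi1 v)) /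
     ((v ^ 2 - F (xi1 v) * v + 1) * (v ^ 2 - F (xi2 v) * v + 1))).
  assert (HdD : forall v, is_derive D v (dD v)).
  { intros v. destruct (HP1 v) as [_ [Hd1 Hl1]]. destruct (HP2 v) as [_ [Hd2 Hl2]].
    fold (F (xi1 v)) in *. fold (F (xi2 v)) in *.
    eapply is_derive_eq. apply (is_derive_minus _ _ _ _ _ Hl1 Hl2).
    unfold minus, plus, opp, dD; simpl. field. simpl in *; lra. }
  assert (Hln : forall p q, 0 < p -> 0 < q -> 0 < ln p - ln q -> q < p).
  { intros p q Hp Hq Hpq. apply ln_lt_inv; lra. }
  assert (HDdD : forall v, D v <> 0 -> v <> 0 -> 0 < - (2 * D v * dD v)).
  { intros v HD Hv. destruct (HP1 v) as [HJ1 [Hd1 _]]. destruct (HP2 v) as [HJ2 [Hd2 _]].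
    assert (Hu1 := hs_u_pos _ _ _ _ HS _ HJ1). assert (Hu2 := hs_u_pos _ _ _ _ HS _ HJ2).
    assert (Hsg : 0 < D v * (F (xi1 v) - F (xi2 v))).
    { unfold D in *. destruct (Rdichotomy _ _ HD) as [Hn|Hp].
      - assert (u (xi1 v) < u (xi2 v)) by (apply Hln; lra).
        assert (F (xi1 v) < F (xi2 v)) by (apply (hs_slope_incr _ _ _ _ HS); auto). nra.
      - assert (u (xi2 v) < u (xi1 v)) by (apply Hln; lra).
        assert (F (xi2 v) < F (xi1 v)) by (apply (hs_slope_incr _ _ _ _ HS); auto). nra. }
    fold (F (xi1 v)) in *. fold (F (xi2 v)) in *.
    assert (Hv2 : 0 < v ^ 2) by (apply pow2_gt_0; auto).
    set (q := (v ^ 2 - F (xi1 v) * v + 1) * (v ^ 2 - F (xi2 v) * v + 1)).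
    assert (Hq : 0 < q) by (apply Rmult_lt_0_compat; auto).
    replace (- (2 * D v * dD v)) with (2 * v ^ 2 * (D v * (F (xi1 v) - F (xi2 v))) / q)
      by (unfold dD; fold q; field; lra).
    apply Rdiv_lt_0_compat; auto. apply Rmult_lt_0_compat; lra. }
  assert (HDsq : forall v, is_derive (fun v => - D v ^ 2) v (- (2 * D v * dD v))).
  { intros v. eapply is_derive_eq.
    - apply (is_derive_opp (fun v => D v ^ 2)). apply is_derive_pow. apply HdD.
    - unfold opp; simpl. ring. }
  assert (Hmono : forall v v', v <= v' -> D v' ^ 2 <= D v ^ 2).
  { intros v v' Hv. apply Ropp_le_cancel.
    apply (derive_nonneg_le (fun v => - D v ^ 2) (fun v => - (2 * D v * dD v)) v v' Hv).
    - intros t _. apply HDsq.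
    - intros t _. eapply is_derive_continuity_pt, HDsq.
    - intros t _. destruct (Req_dec (D t) 0) as [H|H]; [rewrite H; lra|].
      destruct (Req_dec t 0) as [H0|H0]; [|left; auto].
      right. unfold dD. rewrite H0. unfold Rdiv. ring. }
  assert (HDs : is_lim D m_infty ds).
  { apply (is_lim_ext_loc (fun v => (ln (u (xi1 v)) + ln (- v)) - (ln (u (xi2 v)) + ln (- v)))).
    - exists 0. intros v _. unfold D. ring.
    - apply is_lim_minus'; assumption. }
  assert (HDe : is_lim D p_infty de).
  { apply (is_lim_ext_loc (fun v => (ln (u (xi1 v)) + ln v) - (ln (u (xi2 v)) + ln v))).
    - exists 0. intros v _. unfold D. ring.
    - apply is_lim_minus'; assumption. }
  assert (HDs2 : is_lim (fun v => D v ^ 2) m_infty (ds ^ 2)).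
  { simpl. apply (is_lim_mult D (fun v => D v * 1) _ ds (ds * 1)); simpl; auto.
    apply (is_lim_mult D (fun v => 1) _ ds 1); simpl; auto. apply is_lim_const. }
  assert (HDe2 : is_lim (fun v => D v ^ 2) p_infty (de ^ 2)).
  { simpl. apply (is_lim_mult D (fun v => D v * 1) _ de (de * 1)); simpl; auto.
    apply (is_lim_mult D (fun v => 1) _ de 1); simpl; auto. apply is_lim_const. }
  assert (Hle_s : forall v, D v ^ 2 <= ds ^ 2).
  { intros v. assert (HH : Rbar_le (D v ^ 2) (ds ^ 2)).
    { apply (is_lim_le_loc (fun _ => D v ^ 2) (fun v => D v ^ 2) m_infty).
      - exists v. intros w Hw. apply Hmono. lra.
      - apply is_lim_const.
      - exact HDs2. }
    exact HH. }
  assert (Hle_e : forall v, de ^ 2 <= D v ^ 2).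
  { intros v. assert (HH : Rbar_le (de ^ 2) (D v ^ 2)).
    { apply (is_lim_le_loc (fun v => D v ^ 2) (fun _ => D v ^ 2) p_infty).
      - exists v. intros w Hw. apply Hmono. lra.
      - exact HDe2.
      - apply is_lim_const. }
    exact HH. }
  split; [|split].
  - apply Rle_trans with (D 0 ^ 2); auto.
  (* A zero final gap is smaller at once; otherwise [D^2 >= de^2 > 0] keeps [D] from vanishing, and
     [D^2] decreases strictly somewhere. *)
  - intros Hds. destruct (Req_dec (de ^ 2) 0) as [Hz|Hnz].
    + rewrite Hz. apply pow2_gt_0. exact Hds.
    + assert (HDnz : forall v, D v <> 0).
      { intros v Hv. specialize (Hle_e v). rewrite Hv in Hle_e.
        assert (0 <= de ^ 2) by apply pow2_ge_0. apply Hnz. lra. }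
      (* The interval [[1, 2]] avoids [v = 0], where the factor [v^2] makes [dD] vanish. *)
      assert (- D 1 ^ 2 < - D 2 ^ 2).
      { apply (derive_pos_lt (fun v => - D v ^ 2) (fun v => - (2 * D v * dD v))); [lra| |].
        - intros t _. apply HDsq.
        - intros t Ht. apply HDdD; [apply HDnz|lra]. }
      assert (A1 := Hle_s 1). assert (A2 := Hle_e 2). lra.
  - intros Hds t Ht. destruct (HB1 t Ht) as [v [Hx Hy]]. destruct (HA2 v) as [t' [Hx' Hy']].
    exists t'. destruct (HP1 v) as [HJ1 _]. destruct (HP2 v) as [HJ2 _].
    (* A zero initial gap bounds [D^2] by 0 at every slope, so both half-turns trace the same
       curve. *)
    assert (HD0 : D v = 0).
    { assert (A := Hle_s v). rewrite Hds in A. assert (A' := pow2_ge_0 (D v)).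
      destruct (Req_dec (D v) 0) as [H|H]; auto. apply pow2_gt_0 in H. lra. }
    assert (Hueq : u (xi1 v) = u (xi2 v)).
    { apply ln_inv; [apply (hs_u_pos _ _ _ _ HS); auto..|]. unfold D in HD0. lra. }
    assert (Hxi := hs_u_inj _ _ _ _ HS _ _ HJ1 HJ2 Hueq).
    rewrite Hx, Hy, Hx', Hy', Hxi. auto.
Qed.

(** * Removable singularities at the origin *)

(** The mean value theorem turns the difference quotient at [x] into [dh c] with [c] near [x]. It is
    meant for the origin, where the quotient rule for [f / g] breaks down. *)
Lemma is_derive_of_continuous_derivative (h dh : R -> R) (x : R) :
  locally x (fun t => t <> x -> is_derive h t (dh t)) ->
  continuity_pt h x -> continuity_pt dh x -> is_derive h x (dh x).
Proof.
  intros [d1 Hd] Hc Hdc. apply is_derive_Reals. intros eps Heps.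
  apply continuity_pt_locally with (eps := mkposreal _ Heps) in Hdc.
  destruct Hdc as [d2 Hd2].
  assert (Hdpos : 0 < Rmin d1 d2) by (apply Rmin_pos; apply cond_pos).
  exists (mkposreal _ Hdpos). intros k Hk Hkd. simpl in Hkd.
  assert (Hm1 := Rmin_l d1 d2). assert (Hm2 := Rmin_r d1 d2).
  assert (Hball : forall t, Rmin x (x + k) <= t <= Rmax x (x + k) -> Rabs (t - x) < Rmin d1 d2).
  { intros t [Ht1 Ht2]. apply Rabs_lt_between. apply Rabs_lt_between in Hkd.
    unfold Rmin, Rmax in Ht1, Ht2. destruct (Rle_dec x (x + k)); lra. }
  destruct (MVT_gen h x (x + k) dh) as [c [Hc1 Hc2]].
  - intros t Ht. apply Hd.
    + change (Rabs (t - x) < d1). apply Rlt_le_trans with (2 := Hm1). apply Hball. lra.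
    + intros ->. unfold Rmin, Rmax in Ht. destruct (Rle_dec x (x + k)); lra.
  - intros t Ht. destruct (Req_dec t x) as [->|Hne]; [exact Hc|].
    apply (is_derive_continuity_pt h t (dh t)). apply Hd; [|exact Hne].
    change (Rabs (t - x) < d1). apply Rlt_le_trans with (2 := Hm1). apply Hball. lra.
  - replace ((h (x + k) - h x) / k) with (dh c) by (rewrite Hc2; field; lra).
    apply Hd2. change (Rabs (c - x) < d2). apply Rlt_le_trans with (2 := Hm2). apply Hball. lra.
Qed.

Lemma Rbar_interval_convex (a b : Rbar) (p q x : R) :
  Rbar_interval a b p -> Rbar_interval a b q -> p <= x <= q -> Rbar_interval a b x.
Proof.
  intros [Hp _] [_ Hq] [H1 H2]. split.
  - apply Rbar_lt_le_trans with p; auto.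
  - apply Rbar_le_lt_trans with q; auto.
Qed.

Lemma Rbar_interval_locally (a b : Rbar) (x : R) :
  Rbar_interval a b x -> locally x (Rbar_interval a b).
Proof.
  intros H. apply (open_and _ _ (open_Rbar_gt a) (open_Rbar_lt b)). exact H.
Qed.

Lemma int_from_0_0 (g : R -> R) : int_from_0 g 0 = 0.
Proof. unfold int_from_0. now rewrite RInt_point. Qed.

Lemma is_derive_int_from_0 (a b : Rbar) (g : R -> R) (x : R) :
  Rbar_interval a b 0 -> (forall z, Rbar_interval a b z -> ex_derive g z) ->
  Rbar_interval a b x -> is_derive (int_from_0 g) x (g x).
Proof.
  intros H0 Hg Hx. apply (is_derive_RInt g (int_from_0 g) 0 x).
  - generalize (Rbar_interval_locally a b x Hx). apply filter_imp. intros z Hz.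
    apply (RInt_correct g). apply (ex_RInt_continuous g). intros t Ht.
    apply (ex_derive_continuous g). apply Hg.
    unfold Rmin, Rmax in Ht. destruct (Rle_dec 0 z).
    + now apply Rbar_interval_convex with 0 z.
    + now apply Rbar_interval_convex with z 0.
  - apply (ex_derive_continuous g). now apply Hg.
Qed.

Definition phi (f g : R -> R) (x : R) : R := f x + 2 * extend_at_0 (fg'G f g) x.

(** Fixes the sign [phi >= 0]; under the other sign the pair [- f], [g] is admissible. *)
Record admissible (a b : Rbar) (f g : R -> R) : Prop := {
  adm_0 : Rbar_interval a b 0;
  adm_f : forall x, Rbar_interval a b x -> ex_derive f x;
  adm_g : forall x, Rbar_interval a b x -> ex_derive g x;
  adm_g0 : forall x, Rbar_interval a b x -> (g x = 0 <-> x = 0);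
  adm_Gg : ex_finite_lim (G_over_g g) 0;
  adm_fgG : ex_finite_lim (fg'G f g) 0;
  adm_phi_nonneg : forall x, Rbar_interval a b x -> 0 <= phi f g x;
  adm_phi_pos : forall x, Rbar_interval a b x -> x <> 0 -> 0 < phi f g x
}.

(* If [G / g] tended to [l <> 0], then [|G'| <= K |G|] to the right of [0], and
   Gronwall's inequality would force [G = 0] there. *)
Lemma lim_G_over_g (a b : Rbar) (g : R -> R) :
  Rbar_interval a b 0 -> (forall x, Rbar_interval a b x -> ex_derive g x) ->
  g 0 = 0 -> ex_finite_lim (G_over_g g) 0 -> is_lim (G_over_g g) 0 0.
Proof.
  intros H0 Hg Hg0 [l Hl]. destruct (Req_dec l 0) as [->|Hnz]; [exact Hl|exfalso].
  apply is_lim_spec in Hl.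
  assert (Hl2 : 0 < Rabs l / 2) by (assert (A := Rabs_pos_lt l Hnz); lra).
  destruct (Hl (mkposreal _ Hl2)) as [d1 Hd1]. simpl in Hd1.
  destruct (Rbar_interval_locally a b 0 H0) as [d2 Hd2].
  assert (Hp1 := cond_pos d1). assert (Hp2 := cond_pos d2).
  set (r := Rmin d1 d2 / 2).
  assert (Hm1 := Rmin_l d1 d2). assert (Hm2 := Rmin_r d1 d2).
  assert (Hm : 0 < Rmin d1 d2) by (now apply Rmin_pos).
  assert (Hr : 0 < r) by (unfold r; lra).
  assert (Hball : forall t, 0 <= t <= r -> Rabs (t - 0) < Rmin d1 d2).
  { intros t Ht. rewrite Rminus_0_r, Rabs_pos_eq by lra. unfold r in Ht. lra. }
  assert (HI : forall t, 0 <= t <= r -> Rbar_interval a b t).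
  { intros t Ht. apply Hd2. change (Rabs (t - 0) < d2). specialize (Hball t Ht). lra. }
  assert (Hbound : forall t, 0 < t <= r -> Rabs l / 2 < Rabs (G_over_g g t)).
  { intros t Ht. assert (A : Rabs (G_over_g g t - l) < Rabs l / 2).
    { apply Hd1; [|lra]. change (Rabs (t - 0) < d1). specialize (Hball t). lra. }
    assert (B := Rabs_triang_inv l (G_over_g g t)). rewrite Rabs_minus_sym in B. lra. }
  (* The bound [|G / g| > |l| / 2] amounts to [|g| < K |G|] where [g] is nonzero. *)
  set (K := 2 / Rabs l).
  set (G := int_from_0 g) in *.
  assert (HK : forall t, 0 <= t <= r -> G t * g t <= K * G t ^ 2).
  { intros t Ht. destruct (Req_dec t 0) as [->|Htn].
    - rewrite Hg0. unfold G. rewrite int_from_0_0. lra.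
    - assert (A := Hbound t ltac:(lra)). unfold G_over_g in A. fold G in A.
      destruct (Req_dec (g t) 0) as [Hgt|Hgt].
      + rewrite Hgt. assert (0 < K) by (unfold K; apply Rdiv_lt_0_compat; lra).
        assert (0 <= G t ^ 2) by apply pow2_ge_0. nra.
      + rewrite Rabs_div in A by exact Hgt.
        assert (Hgp := Rabs_pos_lt _ Hgt).
        assert (A1 : Rabs (g t) <= K * Rabs (G t)).
        { apply Rmult_lt_compat_r with (r := K * Rabs (g t)) in A;
            [|unfold K; apply Rmult_lt_0_compat; [apply Rdiv_lt_0_compat; lra|lra]].
          replace (Rabs l / 2 * (K * Rabs (g t))) with (Rabs (g t)) in A
            by (unfold K; field; lra).
          replace (Rabs (G t) / Rabs (g t) * (K * Rabs (g t))) with (K * Rabs (G t)) in A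
            by (field; lra). lra. }
        apply Rle_trans with (Rabs (G t) * Rabs (g t)).
        { rewrite <- Rabs_mult. apply Rle_abs. }
        rewrite <- (pow2_abs (G t)). assert (B := Rabs_pos (G t)). nra. }
  assert (HdG : forall t, 0 <= t <= r -> is_derive G t (g t)).
  { intros t Ht. apply (is_derive_int_from_0 a b); auto. }
  (* Derivative of [- G^2 exp (- 2 K t)]; it is nonnegative because [(G^2)' = 2 G g <= 2 K G^2]. *)
  set (dh := fun t => - ((2 * G t * g t) * exp (- (2 * K) * t) + G t ^ 2 * (- (2 * K) * exp (- (2 * K) * t)))).
  assert (Hdh : forall t, 0 <= t <= r -> is_derive (fun t => - (G t ^ 2 * exp (- (2 * K) * t))) t (dh t)).
  { intros t Ht. eapply is_derive_eq.
    - apply (is_derive_opp (fun t => G t ^ 2 * exp (- (2 * K) * t))).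
      apply (is_derive_mult (fun t => G t ^ 2) (fun t => exp (- (2 * K) * t))).
      + apply is_derive_pow. apply HdG, Ht.
      + apply (is_derive_comp exp (fun t => - (2 * K) * t)).
        * apply is_derive_exp.
        * apply (is_derive_scal (fun t => t)). apply (is_derive_id t).
      + intros; apply Rmult_comm.
    - unfold dh, opp, plus, mult, scal, one; simpl. unfold mult; simpl. ring. }
  assert (HG : - (G 0 ^ 2 * exp (- (2 * K) * 0)) <= - (G r ^ 2 * exp (- (2 * K) * r))).
  { apply (derive_nonneg_le (fun t => - (G t ^ 2 * exp (- (2 * K) * t))) dh); [lra| | |].
    - intros t Ht. apply Hdh. lra.
    - intros t Ht. eapply is_derive_continuity_pt, Hdh. lra.
    - intros t Ht. assert (A := HK t Ht). assert (B := exp_pos (- (2 * K) * t)).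
      replace (dh t) with (2 * (K * G t ^ 2 - G t * g t) * exp (- (2 * K) * t))
        by (unfold dh; ring).
      apply Rmult_le_pos; lra. }
  assert (HG0 : G 0 = 0) by apply int_from_0_0.
  rewrite HG0 in HG. assert (B := exp_pos (- (2 * K) * r)).
  assert (Hr2 := Hbound r ltac:(lra)). unfold G_over_g in Hr2. fold G in Hr2.
  destruct (Req_dec (G r) 0) as [Hz|Hz].
  - rewrite Hz in Hr2. unfold Rdiv in Hr2. rewrite Rmult_0_l, Rabs_R0 in Hr2. lra.
  - apply pow2_gt_0 in Hz. assert (0 < G r ^ 2 * exp (- (2 * K) * r)) by (now apply Rmult_lt_0_compat).
    lra.
Qed.

(* At [0] the value is [0] because the numerator vanishes, whatever [/ 0] is. *)
Definition coefA (f g : R -> R) (x : R) : R := 2 * f x * int_from_0 g x / g x.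

Lemma coefA_mul_g (a b : Rbar) (f g : R -> R) (x : R) :
  admissible a b f g -> Rbar_interval a b x ->
  coefA f g x * g x = 2 * f x * int_from_0 g x.
Proof.
  intros H Hx. unfold coefA. destruct (Req_dec x 0) as [->|Hn].
  - rewrite int_from_0_0. unfold Rdiv. ring.
  - field. intros Hg. apply Hn, (adm_g0 _ _ _ _ H x Hx), Hg.
Qed.

Lemma continuity_pt_extend_at_0 (w : R -> R) :
  ex_finite_lim w 0 -> continuity_pt (extend_at_0 w) 0.
Proof.
  intros [l Hl]. apply continuity_pt_filterlim'.
  unfold extend_at_0 at 2. destruct (Req_EM_T 0 0) as [_|Hn]; [|now elim Hn].
  rewrite (is_lim_unique _ _ _ Hl). simpl.
  apply (filterlim_ext_loc w); [|exact Hl].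
  exists (mkposreal 1 Rlt_0_1). intros t _ Ht. unfold extend_at_0.
  now destruct (Req_EM_T t 0).
Qed.

Lemma continuity_pt_ex_derive (h : R -> R) (x : R) : ex_derive h x -> continuity_pt h x.
Proof. intros [l H]. eapply is_derive_continuity_pt, H. Qed.

(** Away from 0 the product rule for [2 (f / g) G] gives [2 (f / g)' G + 2 f = f + phi]. At 0 the
    function is continuous because [G / g] tends to 0, and the expected derivative is continuous by
    the choice of [extend_at_0], so the formula passes to the limit. *)
Lemma is_derive_coefA (a b : Rbar) (f g : R -> R) (x : R) :
  admissible a b f g -> Rbar_interval a b x ->
  is_derive (coefA f g) x (f x + phi f g x).
Proof.
  intros H Hx.
  assert (Hne : forall z, Rbar_interval a b z -> z <> 0 ->
    is_derive (coefA f g) z (f z + phi f g z)).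
  { intros z Hz Hn.
    assert (Hgz : g z <> 0) by (intros E; apply Hn, (adm_g0 _ _ _ _ H z Hz), E).
    assert (Hq : ex_derive (fun z => f z / g z) z).
    { apply ex_derive_div; [apply (adm_f _ _ _ _ H z Hz)|apply (adm_g _ _ _ _ H z Hz)|exact Hgz]. }
    apply (is_derive_ext (fun z => 2 * (f z / g z * int_from_0 g z))).
    { assert (E : forall t, 2 * (f t / g t * int_from_0 g t) = coefA f g t)
        by (intros t; unfold coefA, Rdiv; ring).
      exact E. }
    eapply is_derive_eq.
    - apply (is_derive_scal (fun z => f z / g z * int_from_0 g z)).
      apply (is_derive_mult (fun z => f z / g z) (int_from_0 g)).
      + apply (Derive_correct _ _ Hq).
      + apply (is_derive_int_from_0 a b); auto; apply H.
      + intros; apply Rmult_comm.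
    - unfold phi, extend_at_0, fg'G. destruct (Req_EM_T z 0); [lra|].
      unfold plus, mult; simpl. field. exact Hgz. }
  destruct (Req_dec x 0) as [->|Hn]; [|now apply Hne].
  assert (Hf : continuity_pt f 0) by (apply continuity_pt_ex_derive, (adm_f _ _ _ _ H 0 Hx)).
  apply (is_derive_of_continuous_derivative (coefA f g) (fun x => f x + phi f g x)).
  - generalize (Rbar_interval_locally a b 0 Hx). apply filter_imp. intros z Hz Hz0. auto.
  - apply continuity_pt_filterlim'.
    assert (E : coefA f g 0 = 2 * f 0 * 0).
    { unfold coefA. rewrite int_from_0_0. unfold Rdiv. ring. }
    rewrite E.
    apply (is_lim_ext (fun x => 2 * f x * G_over_g g x) (coefA f g) 0 (2 * f 0 * 0)).
    { intros t. unfold coefA, G_over_g, Rdiv. ring. }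
    apply (is_lim_mult (fun x => 2 * f x) (G_over_g g) 0 (2 * f 0) 0); [| |exact I].
    + apply (is_lim_scal_l f 2 0 (f 0)). now apply is_lim_continuity.
    + apply (lim_G_over_g a b); try apply H; auto. 
  - apply continuity_pt_plus; [exact Hf|]. apply continuity_pt_plus; [exact Hf|].
    apply continuity_pt_mult.
    + apply continuity_pt_const. now intros ? ?.
    + apply continuity_pt_extend_at_0, H.
Qed.

(** * Periodic functions, extrema and zeros *)

(** The time [s] is chosen before [h], so one shift moves [x] and [y] together into the window. *)
Lemma periodic_reach (T : R) (HT : 0 < T) (t t0 : R) :
  exists s, t0 <= s < t0 + T /\
    forall h : R -> R, (forall r, h (r + T) = h r) -> h s = h t.
Proof.
  assert (Hnat : forall (h : R -> R) n r, (forall r, h (r + T) = h r) -> h (r + INR n * T) = h r).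
  { intros h n r Hh. induction n as [|n IH].
    - simpl. f_equal. ring.
    - rewrite S_INR. replace (r + (INR n + 1) * T) with (r + INR n * T + T) by ring.
      now rewrite Hh. }
  (* [up] returns the least integer strictly above its argument, so [k] is the floor. *)
  set (k := (up ((t - t0) / T) - 1)%Z).
  assert (Hk : IZR k <= (t - t0) / T < IZR k + 1).
  { unfold k. rewrite minus_IZR. destruct (archimed ((t - t0) / T)). lra. }
  exists (t - IZR k * T). split.
  - destruct Hk as [Hk1 Hk2].
    apply Rmult_le_compat_r with (r := T) in Hk1; [|lra].
    apply Rmult_lt_compat_r with (r := T) in Hk2; [|lra].
    replace ((t - t0) / T * T) with (t - t0) in Hk1, Hk2 by (field; lra). lra.
  - intros h Hh. destruct (Z.le_gt_cases 0 k) as [Hz|Hz].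
    + set (n := Z.to_nat k). assert (Hn : IZR k = INR n)
        by (unfold n; now rewrite INR_IZR_INZ, Z2Nat.id by lia). rewrite Hn.
      rewrite <- (Hnat h n (t - INR n * T) Hh). f_equal. ring.
    + set (n := Z.to_nat (- k)). assert (Hn : IZR k = - INR n)
        by (unfold n; rewrite INR_IZR_INZ, Z2Nat.id, opp_IZR by lia; ring). rewrite Hn.
      rewrite <- (Hnat h n t Hh). f_equal. ring.
Qed.

Lemma nonvanishing_same_sign (h : R -> R) (p q : R) :
  (forall z, Rmin p q <= z <= Rmax p q -> continuity_pt h z /\ h z <> 0) ->
  0 < h p -> 0 < h q.
Proof.
  intros H Hp. destruct (Rtotal_order (h q) 0) as [Hq|[Hq|Hq]]; [exfalso|exfalso|exact Hq].
  - destruct (Rtotal_order p q) as [Hpq|[->|Hpq]]; [|lra|].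
    + rewrite Rmin_left, Rmax_right in H by lra.
      destruct (Ranalysis5.IVT_interv (fun z => - h z) p q) as [z [Hz1 Hz2]]; try lra.
      * intros z Hz. apply continuity_pt_opp. apply H. lra.
      * apply (proj2 (H z Hz1)). lra.
    + rewrite Rmin_right, Rmax_left in H by lra.
      destruct (Ranalysis5.IVT_interv h q p) as [z [Hz1 Hz2]]; try lra.
      * intros z Hz. apply H. lra.
      * apply (proj2 (H z Hz1)). lra.
  - apply (proj2 (H q ltac:(split; [apply Rmin_r|apply Rmax_r])) Hq).
Qed.

Lemma derive_pos_local (h : R -> R) (t l : R) :
  is_derive h t l -> 0 < l ->
  exists d, 0 < d /\ (forall r, t < r < t + d -> h t < h r) /\
    (forall r, t - d < r < t -> h r < h t).
Proof.
  intros H Hl. apply is_derive_Reals in H. destruct (H l Hl) as [d Hd].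
  exists d. split; [apply cond_pos|].
  assert (Hk : forall k, k <> 0 -> Rabs k < d -> 0 < (h (t + k) - h t) / k).
  { intros k Hk Hkd. specialize (Hd k Hk Hkd). apply Rabs_lt_between in Hd. lra. }
  split; intros r Hr.
  - assert (A := Hk (r - t) ltac:(lra) ltac:(apply Rabs_lt_between; lra)).
    replace (t + (r - t)) with r in A by ring.
    apply Rmult_lt_compat_r with (r := r - t) in A; [|lra].
    replace ((h r - h t) / (r - t) * (r - t)) with (h r - h t) in A by (field; lra). lra.
  - assert (A := Hk (r - t) ltac:(lra) ltac:(apply Rabs_lt_between; lra)).
    replace (t + (r - t)) with r in A by ring.
    apply Rmult_lt_compat_r with (r := t - r) in A; [|lra].
    replace ((h r - h t) / (r - t) * (t - r)) with (h t - h r) in A by (field; lra). lra.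
Qed.

(** If [c > 0], then [k] is positive just after [t] and [h] exceeds its maximum. For [h = x] and
    [h = - x] this reveals the sign of [g] at the extremes of an orbit. *)
Lemma max_second_derivative (h k : R -> R) (t c : R) :
  (forall r, is_derive h r (k r)) -> is_derive k t c -> (forall r, h r <= h t) ->
  k t = 0 /\ c <= 0.
Proof.
  intros Hh Hk Hmax.
  assert (H0 : k t = 0).
  { destruct (Rtotal_order (k t) 0) as [Hl|[Hl|Hl]]; [exfalso|exact Hl|exfalso].
    - assert (Hd : is_derive (fun r => - h r) t (- k t)) by (apply (is_derive_opp h), Hh).
      destruct (derive_pos_local _ _ _ Hd ltac:(lra)) as [d [Hd0 [_ Hd2]]].
      specialize (Hd2 (t - d / 2) ltac:(lra)). specialize (Hmax (t - d / 2)). lra.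
    - destruct (derive_pos_local _ _ _ (Hh t) Hl) as [d [Hd0 [Hd1 _]]].
      specialize (Hd1 (t + d / 2) ltac:(lra)). specialize (Hmax (t + d / 2)). lra. }
  split; [exact H0|]. apply Rnot_lt_le. intros Hc.
  destruct (derive_pos_local _ _ _ Hk Hc) as [d [Hd0 [Hd1 _]]]. rewrite H0 in Hd1.
  (* Since [k t = 0], growth from [t] itself is only weak; it is strict on an interval away from
     [t]. *)
  assert (A1 : h t <= h (t + d / 4)).
  { apply (derive_nonneg_le h k); [lra|intros; apply Hh| |].
    - intros r _. eapply is_derive_continuity_pt, Hh.
    - intros r Hr. destruct (Req_dec r t) as [->|Hn]; [lra|]. left. apply Hd1. lra. }
  assert (A2 : h (t + d / 4) < h (t + d / 2)).
  { apply (derive_pos_lt h k); [lra|intros; apply Hh|]. intros r Hr. apply Hd1. lra. }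
  specialize (Hmax (t + d / 2)). lra.
Qed.

(** The zero is the supremum of the times in [[p, t]] where [h <= 0]; continuity excludes both signs
    of [h] there. *)
Lemma last_zero (h : R -> R) (p t : R) :
  (forall r, continuity_pt h r) -> p < t -> h p <= 0 -> 0 < h t ->
  exists s, p <= s < t /\ h s = 0 /\ forall r, s < r <= t -> 0 < h r.
Proof.
  intros Hc Hpt Hp Ht.
  destruct (completeness (fun r => p <= r <= t /\ h r <= 0)) as [s [Hs1 Hs2]].
  - exists t. intros r [Hr _]. lra.
  - exists p. split; [lra|exact Hp].
  - assert (Hps : p <= s) by (apply Hs1; split; [lra|exact Hp]).
    assert (Hst : s <= t) by (apply Hs2; intros r [Hr _]; lra).
    assert (Hafter : forall r, s < r <= t -> 0 < h r).
    { intros r Hr. apply Rnot_le_lt. intros Hn.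
      assert (r <= s) by (apply Hs1; split; [lra|exact Hn]). lra. }
    assert (H0 : h s <= 0).
    { apply Rnot_lt_le. intros Hpos.
      assert (A := Hc s). apply continuity_pt_locally with (eps := mkposreal _ Hpos) in A.
      destruct A as [d Hd]. simpl in Hd. assert (Hdp := cond_pos d).
      assert (s <= s - d / 2); [|lra]. apply Hs2. intros r [Hr Hr0].
      apply Rnot_lt_le. intros Hlt. assert (r <= s) by (apply Hs1; split; auto).
      assert (A : Rabs (h r - h s) < h s).
      { apply Hd. change (Rabs (r - s) < d). apply Rabs_lt_between. lra. }
      apply Rabs_lt_between in A. lra. }
    assert (Hst' : s < t) by (destruct Hst as [Hst|Hst]; [exact Hst|subst; lra]).
    exists s. split; [lra|split; [|exact Hafter]].
    apply Rle_antisym; [exact H0|]. apply Rnot_lt_le. intros Hneg.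
    assert (Hpos : 0 < - h s) by lra.
    assert (A := Hc s). apply continuity_pt_locally with (eps := mkposreal _ Hpos) in A.
    destruct A as [d Hd]. simpl in Hd. assert (Hdp := cond_pos d).
    set (r := s + Rmin (d / 2) (t - s)).
    assert (Hm : 0 < Rmin (d / 2) (t - s)) by (apply Rmin_pos; lra).
    assert (Hm1 := Rmin_l (d / 2) (t - s)). assert (Hm2 := Rmin_r (d / 2) (t - s)).
    assert (B := Hafter r ltac:(unfold r; lra)).
    assert (A : Rabs (h r - h s) < - h s).
    { apply Hd. change (Rabs (r - s) < d). apply Rabs_lt_between. unfold r. lra. }
    apply Rabs_lt_between in A. lra.
Qed.

(** The zeros of [k] in [[p, q]] form a compact set, so its image under [h] contains its
    supremum. *)
Lemma max_on_zero_set (k h : R -> R) (p q z : R) :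
  (forall r, continuity_pt k r) -> (forall r, continuity_pt h r) ->
  p <= z <= q -> k z = 0 ->
  exists m, p <= m <= q /\ k m = 0 /\
    forall r, p <= r <= q -> k r = 0 -> h r <= h m.
Proof.
  intros Hk Hh Hz Hkz.
  set (Z := fun r => p <= r <= q /\ k r = 0).
  assert (HZ : compact Z).
  { apply compact_P4 with (fun c => p <= c <= q); [apply compact_P3| |now intros r []].
    intros r Hr. destruct (classic (p <= r <= q)) as [Hin|Hout].
    - assert (Hkr : k r <> 0) by (intros E; apply Hr; split; auto).
      assert (A := Hk r). apply continuity_pt_locally with (eps := mkposreal _ (Rabs_pos_lt _ Hkr)) in A.
      destruct A as [d Hd]. exists d. intros r' Hr' [_ E]. specialize (Hd r' Hr'). simpl in Hd.
      rewrite E in Hd. unfold Rminus in Hd. rewrite Rplus_0_l, Rabs_Ropp in Hd. lra.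
    - destruct (compact_P2 _ (compact_P3 p q) r Hout) as [d Hd]. exists d.
      intros r' Hr' [E _]. apply (Hd r' Hr'), E. }
  assert (HS := continuity_compact h Z Hh HZ).
  destruct (compact_P1 _ HS) as [m0 [M0 HM0]].
  destruct (completeness (image_dir h Z)) as [M [HM1 HM2]].
  - exists M0. intros v Hv. apply HM0, Hv.
  - exists (h z). exists z. split; [reflexivity|split; auto].
  - assert (HMS : image_dir h Z M).
    { apply NNPP. intros Hn. destruct (compact_P2 _ HS M Hn) as [d Hd].
      assert (Hdp := cond_pos d). assert (M <= M - d / 2); [|lra].
      apply HM2. intros v Hv. apply Rnot_lt_le. intros Hlt.
      assert (v <= M) by (now apply HM1).
      apply (Hd v); [|exact Hv]. apply Rabs_lt_between. lra. }
    destruct HMS as [m [Hm [Hm1 Hm2]]]. exists m. split; [exact Hm1|split; [exact Hm2|]].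
    intros r Hr1 Hr2. rewrite <- Hm. apply HM1. exists r. split; [reflexivity|split; auto].
Qed.

(** * Periodic solutions and the function [V] *)

Record cycle (a b : Rbar) (f g x y : R -> R) (T : R) : Prop := {
  cy_dx : forall t, is_derive x t (y t);
  cy_dy : forall t, is_derive y t (- f (x t) * y t - g (x t));
  cy_T : 0 < T;
  cy_px : forall t, x (t + T) = x t;
  cy_py : forall t, y (t + T) = y t;
  cy_nonconst : exists t, ~ (x t = x 0 /\ y t = y 0);
  cy_in : forall t, Rbar_interval a b (x t)
}.

Lemma continuous_along_cycle (a b : Rbar) (f g x y : R -> R) (T t : R) :
  (forall z, Rbar_interval a b z -> ex_derive f z) -> cycle a b f g x y T ->
  continuous (fun t => f (x t)) t.
Proof.
  intros Hf C. apply (ex_derive_continuous (fun t => f (x t))).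
  apply (ex_derive_comp f x).
  - apply Hf, (cy_in _ _ _ _ _ _ _ C).
  - eexists. apply (cy_dx _ _ _ _ _ _ _ C).
Qed.

(** This is [V]. *)
Definition dulac (f g : R -> R) (x y : R) : R :=
  y ^ 2 + coefA f g x * y + 2 * int_from_0 g x.

Lemma is_derive_dulac (a b : Rbar) (f g x y : R -> R) (T t : R) :
  admissible a b f g -> cycle a b f g x y T ->
  is_derive (fun t => dulac f g (x t) (y t)) t
    (- f (x t) * dulac f g (x t) (y t) + phi f g (x t) * y t ^ 2).
Proof.
  intros H C. assert (Hin := cy_in _ _ _ _ _ _ _ C t).
  assert (HA := coefA_mul_g _ _ _ _ _ H Hin).
  assert (Hdx := cy_dx _ _ _ _ _ _ _ C t). assert (Hdy := cy_dy _ _ _ _ _ _ _ C t).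
  unfold dulac. eapply is_derive_eq.
  - apply (is_derive_plus (fun t => y t ^ 2 + coefA f g (x t) * y t) (fun t => 2 * int_from_0 g (x t))).
    + apply (is_derive_plus (fun t => y t ^ 2) (fun t => coefA f g (x t) * y t)).
      * apply is_derive_pow. exact Hdy.
      * apply (is_derive_mult (fun t => coefA f g (x t)) y).
        -- apply (is_derive_comp (coefA f g) x); [|exact Hdx].
           apply (is_derive_coefA a b); assumption.
        -- exact Hdy.
        -- intros; apply Rmult_comm.
    + apply (is_derive_scal (fun t => int_from_0 g (x t))).
      apply (is_derive_comp (int_from_0 g) x); [|exact Hdx].
      apply (is_derive_int_from_0 a b); try apply H; assumption.
  (* [HA] trades [coefA * g] for [2 f G], which completes the term [- f V]. *)
  - unfold plus, mult, scal; simpl. unfold mult; simpl. nra.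
Qed.

(** Near a time with [y] nonzero, [x] would vanish identically and so would [y = x']. Hence [y = 0]
    throughout and the solution is constant. This makes the growth of [V exp (int f)] strict, as
    [phi y^2] vanishes only where [x y = 0]. *)
Lemma cycle_never_rests (a b : Rbar) (f g x y : R -> R) (T t0 : R) :
  cycle a b f g x y T ->
  ~ (forall t, t0 < t < t0 + T -> x t * y t = 0).
Proof.
  intros C H0.
  assert (HT := cy_T _ _ _ _ _ _ _ C).
  assert (Hcy : forall t, continuity_pt y t).
  { intros t. eapply is_derive_continuity_pt, (cy_dy _ _ _ _ _ _ _ C). }
  assert (Hy0 : forall t, t0 < t < t0 + T -> y t = 0).
  { intros t Ht. apply NNPP. intros Hn.
    assert (A := Hcy t). apply continuity_pt_locally with (eps := mkposreal _ (Rabs_pos_lt _ Hn)) in A.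
    destruct A as [d Hd]. simpl in Hd. assert (Hdp := cond_pos d).
    set (d' := Rmin d (Rmin (t - t0) (t0 + T - t))).
    assert (Hd1 : d' <= d) by apply Rmin_l.
    assert (Hd2 : d' <= Rmin (t - t0) (t0 + T - t)) by apply Rmin_r.
    assert (Hd3 := Rmin_l (t - t0) (t0 + T - t)). assert (Hd4 := Rmin_r (t - t0) (t0 + T - t)).
    assert (Hdp' : 0 < d') by (apply Rmin_pos; [lra|apply Rmin_pos; lra]).
    assert (Hx : forall r, t - d' < r < t + d' -> x r = 0).
    { intros r Hr. assert (B := H0 r ltac:(lra)).
      assert (D : Rabs (y r - y t) < Rabs (y t)).
      { apply Hd. change (Rabs (r - t) < d). apply Rabs_lt_between. lra. }
      apply Rmult_integral in B. destruct B as [B|B]; [exact B|exfalso].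
      rewrite B in D. unfold Rminus in D. rewrite Rplus_0_l, Rabs_Ropp in D. lra. }
    apply Hn. rewrite <- (is_derive_unique _ _ _ (cy_dx _ _ _ _ _ _ _ C t)).
    apply is_derive_unique. apply (is_derive_ext_loc (fun _ => 0)).
    - exists (mkposreal _ Hdp'). intros r Hr. symmetry. apply Hx.
      apply Rabs_lt_between in Hr. change (minus r t) with (r - t) in Hr. simpl in Hr. lra.
    - apply (is_derive_const 0). }
  assert (Hy0' : forall t, y t = 0).
  { intros t. destruct (periodic_reach T HT t t0) as [s [Hs Hp]].
    rewrite <- (Hp y (cy_py _ _ _ _ _ _ _ C)).
    (* The open window misses its left end [t0], which continuity recovers. *)
    destruct (Req_dec s t0) as [->|Hn]; [|apply Hy0; lra].
    apply NNPP. intros Hn.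
    assert (A := Hcy t0). apply continuity_pt_locally with (eps := mkposreal _ (Rabs_pos_lt _ Hn)) in A.
    destruct A as [d Hd]. simpl in Hd. assert (Hdp := cond_pos d).
    assert (Hm : 0 < Rmin (d / 2) (T / 2)) by (apply Rmin_pos; lra).
    assert (Hm1 := Rmin_l (d / 2) (T / 2)). assert (Hm2 := Rmin_r (d / 2) (T / 2)).
    set (r := t0 + Rmin (d / 2) (T / 2)).
    assert (D : Rabs (y r - y t0) < Rabs (y t0)).
    { apply Hd. change (Rabs (r - t0) < d). apply Rabs_lt_between. unfold r. lra. }
    rewrite (Hy0 r) in D by (unfold r; lra).
    unfold Rminus in D. rewrite Rplus_0_l, Rabs_Ropp in D. lra. }
  destruct (cy_nonconst _ _ _ _ _ _ _ C) as [t Ht]. apply Ht. rewrite !Hy0'. split; [|reflexivity].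
  destruct (MVT_gen x 0 t y) as [c [_ Hc]].
  - intros r _. apply (cy_dx _ _ _ _ _ _ _ C).
  - intros r _. eapply is_derive_continuity_pt, (cy_dx _ _ _ _ _ _ _ C).
  - rewrite Hy0' in Hc. lra.
Qed.

(* [(V exp (int f))' = phi y^2 exp (int f)], so [V exp (int f)] grows strictly over a period,
   while [V] itself is periodic. *)
Lemma dulac_gain (a b : Rbar) (f g x y : R -> R) (T t0 : R) :
  admissible a b f g -> cycle a b f g x y T ->
  0 < dulac f g (x t0) (y t0) * (exp (RInt (fun t => f (x t)) t0 (t0 + T)) - 1).
Proof.
  intros H C.
  assert (HT := cy_T _ _ _ _ _ _ _ C).
  assert (Hfx : forall t, continuous (fun t => f (x t)) t)
    by (intros t; apply (continuous_along_cycle a b f g x y T); [apply H|exact C]).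
  set (P := (fun t => RInt (fun t => f (x t)) t0 t) : R -> R).
  set (V := fun t => dulac f g (x t) (y t)).
  set (dh := fun t => phi f g (x t) * y t ^ 2 * exp (P t)).
  assert (HP : forall t, is_derive P t (f (x t))).
  { intros t. apply (is_derive_RInt (fun t => f (x t)) P t0 t); [|apply Hfx].
    apply filter_forall. intros r. apply (RInt_correct (fun t => f (x t))).
    apply (ex_RInt_continuous (fun t => f (x t))). intros; apply Hfx. }
  assert (Hd : forall t, is_derive (fun t => V t * exp (P t)) t (dh t)).
  { intros t. eapply is_derive_eq.
    - apply (is_derive_mult V (fun t => exp (P t))).
      + apply (is_derive_dulac a b f g x y T t H C).
      + apply (is_derive_comp exp P); [apply is_derive_exp|apply HP].
      + intros; apply Rmult_comm.
    - unfold dh, V, plus, mult, scal; simpl. unfold mult; simpl. ring. }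
  assert (Hdh : forall t, 0 <= dh t).
  { intros t. unfold dh. apply Rmult_le_pos; [|left; apply exp_pos].
    apply Rmult_le_pos; [|apply pow2_ge_0].
    apply (adm_phi_nonneg _ _ _ _ H), (cy_in _ _ _ _ _ _ _ C). }
  assert (Hinc : forall p q, p <= q -> V p * exp (P p) <= V q * exp (P q)).
  { intros p q Hpq. apply (derive_nonneg_le (fun t => V t * exp (P t)) dh); auto.
    intros t _. eapply is_derive_continuity_pt, Hd. }
  assert (HP0 : P t0 = 0) by (unfold P; rewrite RInt_point; reflexivity).
  assert (HVT : V (t0 + T) = V t0).
  { unfold V. now rewrite (cy_px _ _ _ _ _ _ _ C), (cy_py _ _ _ _ _ _ _ C). }
  assert (Hlt : V t0 * exp (P t0) < V (t0 + T) * exp (P (t0 + T))).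
  { destruct (Hinc t0 (t0 + T) ltac:(lra)) as [Hl|He]; [exact Hl|exfalso].
    apply (cycle_never_rests _ _ _ _ _ _ _ t0 C). intros t Ht.
    assert (E : dh t = 0).
    { rewrite <- (is_derive_unique _ _ _ (Hd t)). apply is_derive_unique.
      apply (is_derive_ext_loc (fun _ => V t0 * exp (P t0))); [|apply (is_derive_const (V t0 * exp (P t0)))].
      assert (Hm : 0 < Rmin (t - t0) (t0 + T - t)) by (apply Rmin_pos; lra).
      exists (mkposreal _ Hm). intros r Hr. apply Rabs_lt_between in Hr.
      change (minus r t) with (r - t) in Hr. simpl in Hr.
      assert (Hm1 := Rmin_l (t - t0) (t0 + T - t)). assert (Hm2 := Rmin_r (t - t0) (t0 + T - t)).
      assert (A1 := Hinc t0 r ltac:(lra)). assert (A2 := Hinc r (t0 + T) ltac:(lra)). 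
      apply Rle_antisym; lra. }
    unfold dh in E. destruct (Req_dec (x t) 0) as [->|Hx]; [apply Rmult_0_l|].
    assert (Hp := adm_phi_pos _ _ _ _ H _ (cy_in _ _ _ _ _ _ _ C t) Hx).
    assert (He' := exp_pos (P t)).
    apply Rmult_integral in E. destruct E as [E|E]; [|lra].
    apply Rmult_integral in E. destruct E as [E|E]; [lra|].
    destruct (Req_dec (y t) 0) as [->|Hy]; [ring|]. apply pow2_gt_0 in Hy. lra. }
  rewrite HP0, exp_0, HVT in Hlt. fold (P (t0 + T)). unfold V in Hlt. lra.
Qed.

Lemma hyperbolic_cycle (a b : Rbar) (f g x y : R -> R) (T t0 : R) :
  admissible a b f g -> cycle a b f g x y T ->
  RInt (fun t => f (x t)) t0 (t0 + T) <> 0.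
Proof.
  intros H C E. assert (A := dulac_gain _ _ _ _ _ _ _ t0 H C).
  rewrite E, exp_0 in A. lra.
Qed.


(** * The sign of [g] and the position of a cycle *)

(** The hypotheses of the theorem leave the signs of [g] open; the existence of a cycle forces
    these. *)
Record center_like (a b : Rbar) (g : R -> R) : Prop := {
  cl_pos : forall x, Rbar_interval a b x -> 0 < x -> 0 < g x;
  cl_neg : forall x, Rbar_interval a b x -> x < 0 -> g x < 0
}.

(** Being continuous and nonzero off the origin, [g] keeps one sign on each side, so its opposite
    signs at [p] and [q] put these points on opposite sides. *)
Lemma center_like_of_points (a b : Rbar) (g : R -> R) (p q : R) :
  (forall x, Rbar_interval a b x -> ex_derive g x) ->
  (forall x, Rbar_interval a b x -> (g x = 0 <-> x = 0)) ->
  Rbar_interval a b p -> Rbar_interval a b q -> p <= q -> g p < 0 -> 0 < g q ->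
  center_like a b g /\ p < 0 < q.
Proof.
  intros Hg Hg0 Hp Hq Hpq Hgp Hgq.
  assert (Hpn : p <> 0) by (intros E; apply (Hg0 p Hp) in E; lra).
  assert (Hqn : q <> 0) by (intros E; apply (Hg0 q Hq) in E; lra).
  assert (Hside : forall p' q', Rbar_interval a b p' -> Rbar_interval a b q' -> 0 < p' * q' ->
    forall z, Rmin p' q' <= z <= Rmax p' q' -> continuity_pt g z /\ g z <> 0).
  { intros p' q' Hp' Hq' Hs z [Hz1 Hz2].
    assert (Hz : Rbar_interval a b z /\ z <> 0).
    { unfold Rmin, Rmax in Hz1, Hz2. destruct (Rle_dec p' q') as [Hle|Hle]; split.
      - now apply Rbar_interval_convex with p' q'.
      - intros ->. nra.
      - now apply Rbar_interval_convex with q' p'.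
      - intros ->. nra. }
    split; [apply continuity_pt_ex_derive, Hg, Hz|].
    intros E. apply (Hg0 z (proj1 Hz)) in E. now apply Hz. }
  assert (Hup : forall z, Rbar_interval a b z -> 0 < q * z -> 0 < g z).
  { intros z Hz Hs. apply (nonvanishing_same_sign g q z); [|exact Hgq]. now apply Hside. }
  assert (Hdown : forall z, Rbar_interval a b z -> 0 < p * z -> 0 < - g z).
  { intros z Hz Hs. apply (nonvanishing_same_sign (fun z => - g z) p z); [|lra].
    intros r Hr. destruct (Hside p z Hp Hz Hs r Hr) as [A1 A2].
    split; [now apply continuity_pt_opp|lra]. }
  assert (Hopp : p < 0 < q).
  { destruct (Rtotal_order p 0) as [H1|[H1|H1]]; [|contradiction|].
    - split; [exact H1|]. apply Rnot_le_lt. intros H2.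
      assert (A := Hup p Hp ltac:(nra)). lra.
    - assert (A := Hup p Hp ltac:(nra)). lra. }
  split; [|exact Hopp]. split.
  - intros z Hz H0. apply Hup; [exact Hz|nra].
  - intros z Hz H0. assert (A := Hdown z Hz ltac:(nra)). lra.
Qed.

Lemma int_from_0_pos (a b : Rbar) (g : R -> R) (x : R) :
  Rbar_interval a b 0 -> (forall x, Rbar_interval a b x -> ex_derive g x) ->
  g 0 = 0 -> center_like a b g -> Rbar_interval a b x -> x <> 0 -> 0 < int_from_0 g x.
Proof.
  intros H0 Hg Hg0 [Hp Hn] Hx Hne.
  rewrite <- (int_from_0_0 g).
  destruct (Rdichotomy _ _ Hne) as [Hs|Hs].
  - assert (HI : forall t, x <= t <= 0 -> Rbar_interval a b t)
      by (intros t Ht; apply Rbar_interval_convex with x 0; auto).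
    assert (Hd : forall t, x <= t <= 0 -> is_derive (fun t => - int_from_0 g t) t (- g t)).
    { intros t Ht. apply (is_derive_opp (int_from_0 g)), (is_derive_int_from_0 a b); auto. }
    (* The split at [x / 2] separates strict monotonicity from the weak one near 0, where [g]
       vanishes. *)
    assert (A1 : - int_from_0 g x < - int_from_0 g (x / 2)).
    { apply (derive_pos_lt (fun t => - int_from_0 g t) (fun t => - g t)); [lra| |].
      - intros t Ht. apply Hd. lra.
      - intros t Ht. assert (A := Hn t (HI t ltac:(lra)) ltac:(lra)). lra. }
    assert (A2 : - int_from_0 g (x / 2) <= - int_from_0 g 0).
    { apply (derive_nonneg_le (fun t => - int_from_0 g t) (fun t => - g t)); [lra| | |].
      - intros t Ht. apply Hd. lra.
      - intros t Ht. eapply is_derive_continuity_pt, Hd. lra.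
      - intros t Ht. destruct (Req_dec t 0) as [->|Ht0]; [lra|].
        assert (A := Hn t (HI t ltac:(lra)) ltac:(lra)). lra. }
    lra.
  - assert (HI : forall t, 0 <= t <= x -> Rbar_interval a b t)
      by (intros t Ht; apply Rbar_interval_convex with 0 x; auto).
    assert (Hd : forall t, 0 <= t <= x -> is_derive (int_from_0 g) t (g t)).
    { intros t Ht. apply (is_derive_int_from_0 a b); auto. }
    assert (A1 : int_from_0 g (x / 2) < int_from_0 g x).
    { apply (derive_pos_lt (int_from_0 g) g); [lra| |].
      - intros t Ht. apply Hd. lra.
      - intros t Ht. apply Hp; [apply HI|]; lra. }
    assert (A2 : int_from_0 g 0 <= int_from_0 g (x / 2)).
    { apply (derive_nonneg_le (int_from_0 g) g); [lra| | |].
      - intros t Ht. apply Hd. lra.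
      - intros t Ht. eapply is_derive_continuity_pt, Hd. lra.
      - intros t Ht. destruct (Req_dec t 0) as [->|Ht0]; [lra|].
        left. apply Hp; [apply HI|]; lra. }
    lra.
Qed.

Lemma periodic_max (h : R -> R) (T : R) :
  0 < T -> (forall t, h (t + T) = h t) -> (forall t, continuity_pt h t) ->
  exists m, forall t, h t <= h m.
Proof.
  intros HT Hp Hc. destruct (continuity_ab_maj h 0 T) as [m [Hm _]]; [lra|intros; apply Hc|].
  exists m. intros t. destruct (periodic_reach T HT t 0) as [s [Hs Hh]].
  rewrite <- (Hh h Hp). apply Hm. lra.
Qed.

(** Where [x] is extremal, [y = 0] and [x'' = - g], so [g >= 0] at the maximum and [g <= 0] at the
    minimum. Neither value is 0: the orbit would pass through the origin, where [V = 0], against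
    [dulac_gain]. Thus [g] takes both signs. *)
Lemma cycle_shape (a b : Rbar) (f g x y : R -> R) (T : R) :
  admissible a b f g -> cycle a b f g x y T ->
  center_like a b g /\ (exists t, 0 < x t) /\ (exists t, x t < 0) /\
  (forall t, 0 < dulac f g (x t) (y t)).
Proof.
  intros H C.
  assert (HT := cy_T _ _ _ _ _ _ _ C).
  assert (Hdx := cy_dx _ _ _ _ _ _ _ C). assert (Hdy := cy_dy _ _ _ _ _ _ _ C).
  assert (Hin := cy_in _ _ _ _ _ _ _ C).
  assert (HV : forall t, dulac f g (x t) (y t) <> 0).
  { intros t E. assert (A := dulac_gain _ _ _ _ _ _ _ t H C). rewrite E in A. lra. }
  assert (Hrest : forall t, y t = 0 -> g (x t) <> 0).
  { intros t Hy E. apply (HV t). apply (adm_g0 _ _ _ _ H _ (Hin t)) in E.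
    unfold dulac. rewrite Hy, E, int_from_0_0. ring. }
  assert (Hcx : forall t, continuity_pt x t) by (intros t; eapply is_derive_continuity_pt, Hdx).
  destruct (periodic_max x T HT (cy_px _ _ _ _ _ _ _ C) Hcx) as [M HM].
  destruct (periodic_max (fun t => - x t) T HT) as [m Hm].
  { intros t. now rewrite (cy_px _ _ _ _ _ _ _ C). }
  { intros t. apply continuity_pt_opp, Hcx. }
  destruct (max_second_derivative x y M _ Hdx (Hdy M) HM) as [HyM HgM].
  destruct (max_second_derivative (fun t => - x t) (fun t => - y t) m (- (- f (x m) * y m - g (x m))))
    as [Hym Hgm].
  { intros r. apply (is_derive_opp x), Hdx. }
  { apply (is_derive_opp y), Hdy. }
  { exact Hm. }
  assert (Hym' : y m = 0) by lra. clear Hym.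
  rewrite HyM in HgM. rewrite Hym' in Hgm.
  assert (AM := Hrest M HyM). assert (Am := Hrest m Hym').
  destruct (center_like_of_points a b g (x m) (x M)) as [Hcl Hopp];
    [apply H|apply H|apply Hin|apply Hin|apply HM|lra|lra|].
  split; [exact Hcl|]. split; [exists M; lra|]. split; [exists m; lra|].
  intros t. apply (nonvanishing_same_sign (fun t => dulac f g (x t) (y t)) M t).
  - intros z _. split; [|apply HV]. eapply is_derive_continuity_pt.
    apply (is_derive_dulac a b f g x y T z H C).
  - unfold dulac. rewrite HyM.
    assert (0 < int_from_0 g (x M)); [|lra].
    apply (int_from_0_pos a b); [apply H|apply H| |exact Hcl|apply Hin|lra].
    apply (adm_g0 _ _ _ _ H 0 (adm_0 _ _ _ _ H)). reflexivity.
Qed.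

(** * The coordinate [u] on the two sides of the origin *)

Lemma is_derive_neg (x : R) : is_derive (fun z : R => - z) x (- 1).
Proof. auto_derive; auto; ring. Qed.

Definition sqrt2G (g : R -> R) (x : R) : R := sqrt (2 * int_from_0 g x).

Lemma sqrt2G_sq (g : R -> R) (x : R) :
  0 <= int_from_0 g x -> sqrt2G g x * sqrt2G g x = 2 * int_from_0 g x.
Proof. intros H. apply sqrt_sqrt. lra. Qed.

Section Sides.
Context (a b : Rbar) (f g : R -> R) (H : admissible a b f g) (Hcl : center_like a b g).

Lemma int_from_0_gt (x : R) : Rbar_interval a b x -> x <> 0 -> 0 < int_from_0 g x.
Proof.
  intros Hx Hn. apply (int_from_0_pos a b); auto; [apply H|apply H|].
  now apply (adm_g0 _ _ _ _ H 0 (adm_0 _ _ _ _ H)).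
Qed.

Lemma sqrt2G_pos (x : R) : Rbar_interval a b x -> x <> 0 -> 0 < sqrt2G g x.
Proof. intros Hx Hn. apply sqrt_lt_R0. assert (A := int_from_0_gt x Hx Hn). lra. Qed.

Lemma is_derive_sqrt2G (x : R) : Rbar_interval a b x -> x <> 0 ->
  is_derive (sqrt2G g) x (g x / sqrt2G g x).
Proof.
  intros Hx Hn. assert (A := int_from_0_gt x Hx Hn). assert (B := sqrt2G_pos x Hx Hn).
  eapply is_derive_eq.
  - apply (is_derive_sqrt (fun x => 2 * int_from_0 g x)); [|lra].
    apply (is_derive_scal (int_from_0 g)). apply (is_derive_int_from_0 a b); auto; apply H.
  - fold (sqrt2G g x). field. lra.
Qed.

Lemma is_derive_slope (x : R) : Rbar_interval a b x -> x <> 0 ->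
  is_derive (fun x => f x * sqrt2G g x / g x) x (phi f g x / sqrt2G g x).
Proof.
  intros Hx Hn. assert (A := int_from_0_gt x Hx Hn). assert (B := sqrt2G_pos x Hx Hn).
  assert (Hgx : g x <> 0) by (intros E; apply Hn, (adm_g0 _ _ _ _ H x Hx), E).
  assert (Hq : ex_derive (fun z => f z / g z) x).
  { apply ex_derive_div; [apply (adm_f _ _ _ _ H x Hx)|apply (adm_g _ _ _ _ H x Hx)|exact Hgx]. }
  apply (is_derive_ext (fun z => f z / g z * sqrt2G g z)).
  { assert (E : forall t, f t / g t * sqrt2G g t = f t * sqrt2G g t / g t)
      by (intros t; unfold Rdiv; ring).
    exact E. }
  eapply is_derive_eq.
  - apply (is_derive_mult (fun z => f z / g z) (sqrt2G g)).
    + apply (Derive_correct _ _ Hq).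
    + now apply is_derive_sqrt2G.
    + intros; apply Rmult_comm.
  - unfold phi, extend_at_0, fg'G. destruct (Req_EM_T x 0) as [|_]; [contradiction|].
    unfold plus, mult; simpl. set (d := Derive _ x).
    (* Writing [2 G] as [u^2] identifies [(f / g)' u + f / u] with [phi / u]. *)
    assert (S := sqrt2G_sq g x ltac:(lra)).
    replace (2 * (d * int_from_0 g x)) with (d * (2 * int_from_0 g x)) by ring.
    rewrite <- S. field. split; lra.
Qed.

Lemma sqrt2G_0 : sqrt2G g 0 = 0.
Proof. unfold sqrt2G. rewrite int_from_0_0, Rmult_0_r. apply sqrt_0. Qed.

Lemma continuity_sqrt2G_0 : continuity_pt (sqrt2G g) 0.
Proof.
  apply (continuity_pt_comp (fun x => 2 * int_from_0 g x) sqrt).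
  - apply continuity_pt_mult; [apply continuity_pt_const; now intros ? ?|].
    apply (is_derive_continuity_pt _ _ (g 0)).
    apply (is_derive_int_from_0 a b); apply H.
  - apply continuity_pt_filterlim, continuous_sqrt.
Qed.

(** The condition [0 < x * x'] places both points on the same side. On the left [u] decreases with
    [x], whereas [F = f u / g] increases with [x] on either side. *)
Lemma side_monotone (x x' : R) :
  Rbar_interval a b x -> Rbar_interval a b x' -> x < x' ->
  (0 < x -> sqrt2G g x < sqrt2G g x') /\ (x' < 0 -> sqrt2G g x' < sqrt2G g x) /\
  (0 < x * x' -> f x * sqrt2G g x / g x < f x' * sqrt2G g x' / g x').
Proof.
  intros Hx Hx' Hlt.
  assert (HI : forall t, x <= t <= x' -> Rbar_interval a b t)
    by (intros t Ht; now apply Rbar_interval_convex with x x').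
  split; [|split]; intros Hs.
  - apply (derive_pos_lt (sqrt2G g) (fun t => g t / sqrt2G g t)); auto; intros t Ht.
    + apply is_derive_sqrt2G; [auto|lra].
    + apply Rdiv_lt_0_compat; [apply (cl_pos _ _ _ Hcl); [auto|lra]|apply sqrt2G_pos; [auto|lra]].
  - apply Ropp_lt_cancel.
    apply (derive_pos_lt (fun t => - sqrt2G g t) (fun t => - (g t / sqrt2G g t))); auto; intros t Ht.
    + apply (is_derive_opp (sqrt2G g)), is_derive_sqrt2G; [auto|lra].
    + replace (- (g t / sqrt2G g t)) with (- g t / sqrt2G g t) by (unfold Rdiv; ring).
      assert (A := cl_neg _ _ _ Hcl t (HI t Ht) ltac:(lra)).
      apply Rdiv_lt_0_compat; [lra|apply sqrt2G_pos; [auto|lra]].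
  - apply (derive_pos_lt (fun t => f t * sqrt2G g t / g t) (fun t => phi f g t / sqrt2G g t)); auto;
      intros t Ht; assert (t <> 0) by nra.
    + now apply is_derive_slope; [apply HI|].
    + apply Rdiv_lt_0_compat; [apply (adm_phi_pos _ _ _ _ H)|apply sqrt2G_pos]; auto.
Qed.

Lemma half_strip_right :
  half_strip (fun z => Rbar_interval a b z /\ 0 < z) f g (sqrt2G g).
Proof.
  split.
  - intros x [Hx H0]. apply sqrt2G_pos; [auto|lra].
  - intros x [Hx H0]. now apply (cl_pos _ _ _ Hcl).
  - intros x [Hx H0]. apply is_derive_sqrt2G; [auto|lra].
  - apply continuity_sqrt2G_0.
  - apply sqrt2G_0.
  - intros x x' [Hx H0] [Hx' H0'] E. destruct (Rtotal_order x x') as [L|[L|L]]; auto; exfalso.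
    + assert (A := proj1 (side_monotone x x' Hx Hx' L) H0). lra.
    + assert (A := proj1 (side_monotone x' x Hx' Hx L) H0'). lra.
  - intros x x' [Hx H0] [Hx' H0'] E. destruct (Rtotal_order x x') as [L|[L|L]].
    + apply (side_monotone x x' Hx Hx' L). nra.
    + subst. lra.
    + assert (A := proj1 (side_monotone x' x Hx' Hx L) H0'). lra.
Qed.

(** The rotation [(x, y) -> (- x, - y)] replaces [f], [g] by [f (- z)], [- g (- z)]. It turns
    [F (x)] into [- F (- z)]: the two sign changes cancel, so the new [F] increases with [z], and so
    does [u (- z)]. *)
Lemma half_strip_left :
  half_strip (fun z => Rbar_interval a b (- z) /\ 0 < z)
    (fun z => f (- z)) (fun z => - g (- z)) (fun z => sqrt2G g (- z)).
Proof.
  split.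
  - intros x [Hx H0]. apply sqrt2G_pos; [auto|lra].
  - intros x [Hx H0]. assert (A := cl_neg _ _ _ Hcl _ Hx). lra.
  - intros x [Hx H0]. eapply is_derive_eq.
    + apply (is_derive_comp (sqrt2G g) (fun z => - z)).
      * apply is_derive_sqrt2G; [auto|lra].
      * apply is_derive_neg.
    + unfold scal; simpl. unfold mult; simpl. unfold Rdiv. ring.
  - apply (continuity_pt_comp (fun z => - z) (sqrt2G g)).
    + apply continuity_pt_opp. apply derivable_continuous_pt, derivable_pt_id.
    + rewrite Ropp_0. apply continuity_sqrt2G_0.
  - rewrite Ropp_0. apply sqrt2G_0.
  - intros x x' [Hx H0] [Hx' H0'] E. destruct (Rtotal_order x x') as [L|[L|L]]; auto; exfalso.
    + assert (A := proj1 (proj2 (side_monotone (- x') (- x) Hx' Hx ltac:(lra))) ltac:(lra)). lra.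
    + assert (A := proj1 (proj2 (side_monotone (- x) (- x') Hx Hx' ltac:(lra))) ltac:(lra)). lra.
  - intros x x' [Hx H0] [Hx' H0'] E.
    replace (f (- x) * sqrt2G g (- x) / - g (- x)) with (- (f (- x) * sqrt2G g (- x) / g (- x)))
      by (unfold Rdiv; rewrite Rinv_opp; ring).
    replace (f (- x') * sqrt2G g (- x') / - g (- x')) with (- (f (- x') * sqrt2G g (- x') / g (- x')))
      by (unfold Rdiv; rewrite Rinv_opp; ring).
    apply Ropp_lt_contravar. destruct (Rtotal_order x x') as [L|[L|L]].
    + apply (side_monotone (- x') (- x) Hx' Hx); [lra|nra].
    + subst. lra.
    + assert (A := proj1 (proj2 (side_monotone (- x) (- x') Hx Hx' ltac:(lra))) ltac:(lra)). lra.
Qed.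

End Sides.

(** * Excursions between crossings of the [y]-axis *)

(** The start [s] is the last zero of [x] before the excursion; [p] ensures that there is one. As
    [x > 0] just after [s], [y s < 0] is impossible, and transversality excludes [y s = 0]. *)
Lemma excursion_back (x y : R -> R) (e p : R) :
  (forall t, is_derive x t (y t)) -> (forall t, x t = 0 -> y t <> 0) ->
  x e = 0 -> y e < 0 -> p < e -> x p <= 0 ->
  exists s, s < e /\ x s = 0 /\ 0 < y s /\ forall t, s < t < e -> 0 < x t.
Proof.
  intros Hdx Hne Hxe Hye Hp Hxp.
  assert (Hc : forall t, continuity_pt x t) by (intros t; eapply is_derive_continuity_pt, Hdx).
  assert (Hd : is_derive (fun t => - x t) e (- y e)) by (apply (is_derive_opp x), Hdx).
  destruct (derive_pos_local _ _ _ Hd ltac:(lra)) as [d [Hd0 [_ Hd1]]].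
  assert (Hpos : forall r, e - d < r < e -> 0 < x r) by (intros r Hr; specialize (Hd1 r Hr); lra).
  assert (Hpd : p <= e - d) by (apply Rnot_lt_le; intros Hl; assert (A := Hpos p ltac:(lra)); lra).
  destruct (last_zero x p (e - d / 2)) as [s [Hs [Hxs Hafter]]]; [exact Hc|lra|exact Hxp|apply Hpos; lra|].
  exists s. split; [lra|]. split; [exact Hxs|].
  assert (Hin : forall t, s < t < e -> 0 < x t).
  { intros t Ht. destruct (Rle_or_lt t (e - d / 2)); [apply Hafter; lra|apply Hpos; lra]. }
  split; [|exact Hin].
  destruct (Rtotal_order (y s) 0) as [Hy|[Hy|Hy]]; [exfalso| |exact Hy].
  - assert (Hds : is_derive (fun t => - x t) s (- y s)) by (apply (is_derive_opp x), Hdx).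
    destruct (derive_pos_local _ _ _ Hds ltac:(lra)) as [d' [Hd0' [Hd1' _]]].
    set (t := s + Rmin (d' / 2) ((e - s) / 2)).
    assert (Hm : 0 < Rmin (d' / 2) ((e - s) / 2)) by (apply Rmin_pos; lra).
    assert (Hm1 := Rmin_l (d' / 2) ((e - s) / 2)). assert (Hm2 := Rmin_r (d' / 2) ((e - s) / 2)).
    assert (A1 := Hd1' t ltac:(unfold t; lra)). assert (A2 := Hin t ltac:(unfold t; lra)). lra.
  - now elim (Hne s Hxs).
Qed.

Lemma excursion_end (x y : R -> R) (t0 q : R) :
  (forall t, is_derive x t (y t)) -> (forall t, x t = 0 -> y t <> 0) ->
  0 < x t0 -> t0 < q -> x q <= 0 ->
  exists e, t0 < e /\ x e = 0 /\ y e < 0 /\ forall t, t0 <= t < e -> 0 < x t.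
Proof.
  intros Hdx Hne Hx0 Hq Hxq.
  assert (Hc : forall t, continuity_pt x t) by (intros t; eapply is_derive_continuity_pt, Hdx).
  (* In reversed time the first zero after [t0] becomes a last zero. *)
  destruct (last_zero (fun t => x (- t)) (- q) (- t0)) as [s [Hs [Hxs Hafter]]].
  - intros r. apply (continuity_pt_comp (fun r => - r) x); [|apply Hc].
    apply continuity_pt_opp, derivable_continuous_pt, derivable_pt_id.
  - lra.
  - now rewrite Ropp_involutive.
  - now rewrite Ropp_involutive.
  - assert (Hin : forall t, t0 <= t < - s -> 0 < x t).
    { intros t Ht. rewrite <- (Ropp_involutive t). apply Hafter. lra. }
    exists (- s). split; [lra|]. split; [exact Hxs|]. split; [|exact Hin].
    destruct (Rtotal_order (y (- s)) 0) as [Hy|[Hy|Hy]]; [exact Hy| |exfalso].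
    + now elim (Hne (- s) Hxs).
    + destruct (derive_pos_local _ _ _ (Hdx (- s)) Hy) as [d [Hd0 [_ Hd1]]].
      set (t := - s - Rmin (d / 2) (- s - t0)).
      assert (Hm : 0 < Rmin (d / 2) (- s - t0)) by (apply Rmin_pos; lra).
      assert (Hm1 := Rmin_l (d / 2) (- s - t0)). assert (Hm2 := Rmin_r (d / 2) (- s - t0)).
      assert (A1 := Hd1 t ltac:(unfold t; lra)). assert (A2 := Hin t ltac:(unfold t; lra)). lra.
Qed.

(** * Comparison of two cycles *)

Section Turns.
Context (a b : Rbar) (f g : R -> R) (H : admissible a b f g).

Definition right_turn := half_turn (fun z => Rbar_interval a b z /\ 0 < z) f g (sqrt2G g).
Definition left_turn (x y : R -> R) :=
  half_turn (fun z => Rbar_interval a b (- z) /\ 0 < z)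
    (fun z => f (- z)) (fun z => - g (- z)) (fun z => sqrt2G g (- z))
    (fun t => - x t) (fun t => - y t).

(** On the [y]-axis [V = y^2], so [V > 0] makes every crossing transversal. *)
Lemma cycle_section (x y : R -> R) (T t : R) :
  cycle a b f g x y T -> x t = 0 -> y t <> 0.
Proof.
  intros C Hx Hy. destruct (cycle_shape _ _ _ _ _ _ _ H C) as [_ [_ [_ HV]]].
  specialize (HV t). unfold dulac in HV. rewrite Hx, Hy, int_from_0_0 in HV. lra.
Qed.

Lemma dulac_sqrt2G (x y : R) :
  center_like a b g -> Rbar_interval a b x -> x <> 0 ->
  y ^ 2 + f x * sqrt2G g x / g x * sqrt2G g x * y + sqrt2G g x ^ 2 = dulac f g x y.
Proof.
  intros Hcl Hx Hn. assert (A := int_from_0_gt a b f g H Hcl x Hx Hn).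
  assert (S := sqrt2G_sq g x ltac:(lra)).
  replace (f x * sqrt2G g x / g x * sqrt2G g x) with (f x * (sqrt2G g x * sqrt2G g x) / g x)
    by (unfold Rdiv; ring).
  replace (sqrt2G g x ^ 2) with (sqrt2G g x * sqrt2G g x) by ring.
  rewrite S. unfold dulac, coefA, Rdiv. ring.
Qed.

Lemma right_turn_intro (x y : R -> R) (T s e : R) :
  cycle a b f g x y T -> s < e -> x s = 0 -> x e = 0 -> 0 < y s -> y e < 0 ->
  (forall t, s < t < e -> 0 < x t) -> right_turn x y s e.
Proof.
  intros C Hse Hxs Hxe Hys Hye Hpos.
  destruct (cycle_shape _ _ _ _ _ _ _ H C) as [Hcl [_ [_ HV]]].
  assert (Hin := cy_in _ _ _ _ _ _ _ C).
  split; auto; try apply C.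
  intros t Ht. rewrite dulac_sqrt2G; auto. specialize (Hpos t Ht). lra.
Qed.

Lemma left_turn_intro (x y : R -> R) (T s e : R) :
  cycle a b f g x y T -> s < e -> x s = 0 -> x e = 0 -> y s < 0 -> 0 < y e ->
  (forall t, s < t < e -> x t < 0) -> left_turn x y s e.
Proof.
  intros C Hse Hxs Hxe Hys Hye Hneg.
  destruct (cycle_shape _ _ _ _ _ _ _ H C) as [Hcl [_ [_ HV]]].
  assert (Hin := cy_in _ _ _ _ _ _ _ C).
  split; try lra.
  - intros t Ht. rewrite Ropp_involutive. specialize (Hneg t Ht). split; [apply Hin|lra].
  - intros t. apply (is_derive_opp x), (cy_dx _ _ _ _ _ _ _ C).
  - intros t. eapply is_derive_eq; [apply (is_derive_opp y), (cy_dy _ _ _ _ _ _ _ C)|].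
    rewrite Ropp_involutive. unfold opp; simpl. ring.
  - intros t Ht. rewrite Ropp_involutive. specialize (Hneg t Ht).
    replace ((- y t) ^ 2 + f (x t) * sqrt2G g (x t) / - g (x t) * sqrt2G g (x t) * - y t + sqrt2G g (x t) ^ 2)
      with (y t ^ 2 + f (x t) * sqrt2G g (x t) / g (x t) * sqrt2G g (x t) * y t + sqrt2G g (x t) ^ 2)
      by (unfold Rdiv; rewrite Rinv_opp; ring).
    rewrite dulac_sqrt2G; auto. lra.
Qed.

Lemma value_taken_before (x y : R -> R) (T e : R) (P : R -> Prop) :
  cycle a b f g x y T -> (exists t, P (x t)) -> exists p, p < e /\ P (x p).
Proof.
  intros C [t Ht].
  destruct (periodic_reach T (cy_T _ _ _ _ _ _ _ C) t (e - T)) as [s [Hs Hp]].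
  exists s. split; [lra|]. now rewrite (Hp x (cy_px _ _ _ _ _ _ _ C)).
Qed.

Lemma value_taken_after (x y : R -> R) (T e : R) (P : R -> Prop) :
  cycle a b f g x y T -> (exists t, P (x t)) -> exists q, e < q /\ P (x q).
Proof.
  intros C [t Ht].
  destruct (periodic_reach T (cy_T _ _ _ _ _ _ _ C) t (e + 1)) as [s [Hs Hp]].
  exists s. split; [lra|]. now rewrite (Hp x (cy_px _ _ _ _ _ _ _ C)).
Qed.

Lemma right_turn_back (x y : R -> R) (T e : R) :
  cycle a b f g x y T -> x e = 0 -> y e < 0 ->
  exists s, x s = 0 /\ 0 < y s /\ s < e /\ right_turn x y s e.
Proof.
  intros C Hx Hy. destruct (cycle_shape _ _ _ _ _ _ _ H C) as [_ [_ [Hneg _]]].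
  destruct (value_taken_before x y T e (fun z => z < 0) C Hneg) as [p [Hp Hxp]].
  destruct (excursion_back x y e p) as [s [Hs [Hxs [Hys Hin]]]]; auto.
  - apply C.
  - intros t. now apply cycle_section with T.
  - lra.
  - exists s. repeat (split; [assumption|]). now apply right_turn_intro with T.
Qed.

Lemma left_turn_back (x y : R -> R) (T e : R) :
  cycle a b f g x y T -> x e = 0 -> 0 < y e ->
  exists s, x s = 0 /\ y s < 0 /\ s < e /\ left_turn x y s e.
Proof.
  intros C Hx Hy. destruct (cycle_shape _ _ _ _ _ _ _ H C) as [_ [Hpos _]].
  destruct (value_taken_before x y T e (fun z => 0 < z) C Hpos) as [p [Hp Hxp]].
  destruct (excursion_back (fun t => - x t) (fun t => - y t) e p) as [s [Hs [Hxs [Hys Hin]]]]; try lra.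
  - intros t. apply (is_derive_opp x), (cy_dx _ _ _ _ _ _ _ C).
  - intros t Ht. assert (A := cycle_section x y T t C). lra.
  - exists s. split; [lra|]. split; [lra|]. split; [assumption|].
    apply left_turn_intro with T; auto; try lra.
    intros t Ht. specialize (Hin t Ht). lra.
Qed.

(** The end [e] is found forward from [t], then the start backward from [e]; it precedes [t] because
    [x > 0] on [[t, e)]. *)
Lemma right_turn_through (x y : R -> R) (T t : R) :
  cycle a b f g x y T -> 0 < x t ->
  exists s e, s < t < e /\ x s = 0 /\ 0 < y s /\ right_turn x y s e.
Proof.
  intros C Hx. destruct (cycle_shape _ _ _ _ _ _ _ H C) as [_ [_ [Hneg _]]].
  destruct (value_taken_after x y T t (fun z => z < 0) C Hneg) as [q [Hq Hxq]].
  destruct (excursion_end x y t q) as [e [He [Hxe [Hye Hin]]]]; auto; try lra.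
  - apply C.
  - intros r. now apply cycle_section with T.
  - destruct (right_turn_back x y T e C Hxe Hye) as [s [Hxs [Hys [Hse HR]]]].
    exists s, e. split; [|auto]. split; [|exact He].
    apply Rnot_le_lt. intros Hts. specialize (Hin s ltac:(lra)). lra.
Qed.

Lemma left_turn_through (x y : R -> R) (T t : R) :
  cycle a b f g x y T -> x t < 0 ->
  exists s e, s < t < e /\ x s = 0 /\ y s < 0 /\ left_turn x y s e.
Proof.
  intros C Hx. destruct (cycle_shape _ _ _ _ _ _ _ H C) as [_ [Hpos _]].
  destruct (value_taken_after x y T t (fun z => 0 < z) C Hpos) as [q [Hq Hxq]].
  destruct (excursion_end (fun t => - x t) (fun t => - y t) t q) as [e [He [Hxe [Hye Hin]]]]; try lra.
  - intros r. apply (is_derive_opp x), (cy_dx _ _ _ _ _ _ _ C).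
  - intros r Hr. assert (A := cycle_section x y T r C). lra.
  - destruct (left_turn_back x y T e C ltac:(lra) ltac:(lra)) as [s [Hxs [Hys [Hse HR]]]].
    exists s, e. split; [|auto]. split; [|exact He].
    apply Rnot_le_lt. intros Hts. specialize (Hin s ltac:(lra)). lra.
Qed.

Lemma left_turn_contracts (x1 y1 x2 y2 : R -> R) (s1 e1 s2 e2 : R) :
  center_like a b g -> left_turn x1 y1 s1 e1 -> left_turn x2 y2 s2 e2 ->
  let ds := ln (- y1 s1) - ln (- y2 s2) in
  let de := ln (y1 e1) - ln (y2 e2) in
  de ^ 2 <= ds ^ 2 /\ (ds <> 0 -> de ^ 2 < ds ^ 2) /\
  (ds = 0 -> forall t, s1 < t < e1 -> exists t', x1 t = x2 t' /\ y1 t = y2 t').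
Proof.
  intros Hcl L1 L2.
  assert (A := half_turn_contracts _ _ _ _ _ _ _ _ _ _ _ _ (half_strip_left a b f g H Hcl) L1 L2).
  cbv beta zeta in A |- *. rewrite !Ropp_involutive in A.
  destruct A as [A1 [A2 A3]]. split; [exact A1|]. split; [exact A2|].
  intros E t Ht. destruct (A3 E t Ht) as [t' [E1 E2]]. exists t'. split; lra.
Qed.

Definition gap (y1 y2 : R -> R) (s1 s2 : R) : R := ln (y1 s1) - ln (y2 s2).

Lemma predecessors (x1 y1 x2 y2 : R -> R) (T1 T2 s1 s2 : R) :
  cycle a b f g x1 y1 T1 -> cycle a b f g x2 y2 T2 ->
  x1 s1 = 0 -> 0 < y1 s1 -> x2 s2 = 0 -> 0 < y2 s2 ->
  exists p1 p2, x1 p1 = 0 /\ 0 < y1 p1 /\ x2 p2 = 0 /\ 0 < y2 p2 /\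
    gap y1 y2 s1 s2 ^ 2 <= gap y1 y2 p1 p2 ^ 2 /\
    (gap y1 y2 p1 p2 <> 0 -> gap y1 y2 s1 s2 ^ 2 < gap y1 y2 p1 p2 ^ 2).
Proof.
  intros C1 C2 Hx1 Hy1 Hx2 Hy2.
  destruct (cycle_shape _ _ _ _ _ _ _ H C1) as [Hcl _].
  destruct (left_turn_back x1 y1 T1 s1 C1 Hx1 Hy1) as [m1 [Hxm1 [Hym1 [_ L1]]]].
  destruct (left_turn_back x2 y2 T2 s2 C2 Hx2 Hy2) as [m2 [Hxm2 [Hym2 [_ L2]]]].
  destruct (right_turn_back x1 y1 T1 m1 C1 Hxm1 Hym1) as [p1 [Hxp1 [Hyp1 [_ R1]]]].
  destruct (right_turn_back x2 y2 T2 m2 C2 Hxm2 Hym2) as [p2 [Hxp2 [Hyp2 [_ R2]]]].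
  exists p1, p2. repeat (split; [assumption|]).
  destruct (left_turn_contracts _ _ _ _ _ _ _ _ Hcl L1 L2) as [A1 _].
  destruct (half_turn_contracts _ _ _ _ _ _ _ _ _ _ _ _ (half_strip_right a b f g H Hcl) R1 R2)
    as [B1 [B2 _]].
  unfold gap. split; [eapply Rle_trans; eassumption|].
  intros Hn. eapply Rle_lt_trans; [exact A1|]. apply B2, Hn.
Qed.

Lemma extremal_crossings (x y : R -> R) (T : R) :
  cycle a b f g x y T ->
  exists m M, x m = 0 /\ 0 < y m /\ x M = 0 /\ 0 < y M /\
    forall s, x s = 0 -> 0 < y s -> y m <= y s <= y M.
Proof.
  intros C. assert (HT := cy_T _ _ _ _ _ _ _ C).
  assert (Hcx : forall t, continuity_pt x t)
    by (intros t; eapply is_derive_continuity_pt, (cy_dx _ _ _ _ _ _ _ C)).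
  assert (Hcy : forall t, continuity_pt y t)
    by (intros t; eapply is_derive_continuity_pt, (cy_dy _ _ _ _ _ _ _ C)).
  set (k := fun t => Rabs (x t) + (Rabs (y t) - y t)).
  assert (Hk : forall t, k t = 0 <-> x t = 0 /\ 0 < y t).
  { intros t. unfold k. assert (A := cycle_section x y T t C). split.
    - intros E. assert (B1 := Rabs_pos (x t)). assert (B2 := Rle_abs (y t)).
      assert (Hx : Rabs (x t) = 0) by lra.
      assert (Hx' : x t = 0) by (destruct (Req_dec (x t) 0) as [|Hn]; [auto|apply Rabs_no_R0 in Hn; lra]).
      split; [exact Hx'|]. assert (B3 := Rabs_pos (y t)). specialize (A Hx'). lra.
    - intros [E1 E2]. rewrite E1, Rabs_R0, Rabs_pos_eq by lra. ring. }
  assert (Hck : forall t, continuity_pt k t).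
  { intros t. apply continuity_pt_plus; [|apply continuity_pt_minus; [|apply Hcy]].
    - apply (continuity_pt_comp x Rabs); [apply Hcx|apply Rcontinuity_abs].
    - apply (continuity_pt_comp y Rabs); [apply Hcy|apply Rcontinuity_abs]. }
  assert (Hred : forall s, exists s', 0 <= s' <= T /\ x s' = x s /\ y s' = y s).
  { intros s. destruct (periodic_reach T HT s 0) as [s' [Hs' Hp]].
    exists s'. split; [lra|]. split; apply Hp; apply C. }
  destruct (cycle_shape _ _ _ _ _ _ _ H C) as [_ [[t Ht] _]].
  destruct (right_turn_through x y T t C Ht) as [z0 [_ [_ [Hxz0 [Hyz0 _]]]]].
  destruct (Hred z0) as [z [Hz [Exz Eyz]]].
  assert (Hkz : k z = 0) by (apply Hk; rewrite Exz, Eyz; auto).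
  destruct (max_on_zero_set k y 0 T z Hck Hcy Hz Hkz) as [M [HM [HkM HmaxM]]].
  destruct (max_on_zero_set k (fun t => - y t) 0 T z Hck) as [m [Hm [Hkm Hmaxm]]]; auto.
  { intros r. apply continuity_pt_opp, Hcy. }
  apply Hk in HkM. apply Hk in Hkm.
  exists m, M. repeat (split; [tauto|]).
  intros s Hxs Hys. destruct (Hred s) as [s' [Hs' [Ex Ey]]].
  assert (Hks : k s' = 0) by (apply Hk; rewrite Ex, Ey; auto).
  specialize (HmaxM s' Hs' Hks). specialize (Hmaxm s' Hs' Hks). simpl in Hmaxm.
  rewrite <- Ey. lra.
Qed.

(* A largest gap between crossings of the positive [y]-axis cannot exceed
   the gap of their predecessors, so it vanishes. *)
Lemma crossings_coincide (x1 y1 x2 y2 : R -> R) (T1 T2 : R) :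
  cycle a b f g x1 y1 T1 -> cycle a b f g x2 y2 T2 ->
  forall s1 s2, x1 s1 = 0 -> 0 < y1 s1 -> x2 s2 = 0 -> 0 < y2 s2 -> gap y1 y2 s1 s2 = 0.
Proof.
  intros C1 C2.
  destruct (extremal_crossings x1 y1 T1 C1) as [m1 [M1 [Hxm1 [Hym1 [HxM1 [HyM1 B1]]]]]].
  destruct (extremal_crossings x2 y2 T2 C2) as [m2 [M2 [Hxm2 [Hym2 [HxM2 [HyM2 B2]]]]]].
  set (d := Rmax (gap y1 y2 M1 m2) (- gap y1 y2 m1 M2)).
  assert (Hb : forall s1 s2, x1 s1 = 0 -> 0 < y1 s1 -> x2 s2 = 0 -> 0 < y2 s2 ->
    - d <= gap y1 y2 s1 s2 <= d).
  { intros s1 s2 Hx1 Hy1 Hx2 Hy2.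
    assert (L1 := ln_le _ _ Hym1 (proj1 (B1 s1 Hx1 Hy1))).
    assert (L2 := ln_le _ _ Hy1 (proj2 (B1 s1 Hx1 Hy1))).
    assert (L3 := ln_le _ _ Hym2 (proj1 (B2 s2 Hx2 Hy2))).
    assert (L4 := ln_le _ _ Hy2 (proj2 (B2 s2 Hx2 Hy2))).
    assert (D1 : gap y1 y2 M1 m2 <= d) by apply Rmax_l.
    assert (D2 : - gap y1 y2 m1 M2 <= d) by apply Rmax_r.
    unfold gap in *. lra. }
  assert (Hd0 : forall s1 s2, x1 s1 = 0 -> 0 < y1 s1 -> x2 s2 = 0 -> 0 < y2 s2 ->
    gap y1 y2 s1 s2 ^ 2 = d ^ 2 -> d = 0).
  { intros s1 s2 Hx1 Hy1 Hx2 Hy2 E.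
    destruct (predecessors x1 y1 x2 y2 T1 T2 s1 s2 C1 C2 Hx1 Hy1 Hx2 Hy2)
      as [p1 [p2 [Hxp1 [Hyp1 [Hxp2 [Hyp2 [Hle Hlt]]]]]]].
    specialize (Hb p1 p2 Hxp1 Hyp1 Hxp2 Hyp2).
    destruct (Req_dec (gap y1 y2 p1 p2) 0) as [Hz|Hn].
    - rewrite Hz, E in Hle. nra.
    - specialize (Hlt Hn). nra. }
  assert (Hd : d = 0).
  { destruct (Rle_or_lt (- gap y1 y2 m1 M2) (gap y1 y2 M1 m2)) as [Hc|Hc].
    - apply (Hd0 M1 m2); auto. unfold d. now rewrite Rmax_left.
    - apply (Hd0 m1 M2); auto. unfold d. rewrite Rmax_right by lra. ring. }
  intros s1 s2 Hx1 Hy1 Hx2 Hy2. specialize (Hb s1 s2 Hx1 Hy1 Hx2 Hy2). lra.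
Qed.

Lemma cycle_included (x1 y1 x2 y2 : R -> R) (T1 T2 t : R) :
  cycle a b f g x1 y1 T1 -> cycle a b f g x2 y2 T2 ->
  exists t', x1 t = x2 t' /\ y1 t = y2 t'.
Proof.
  intros C1 C2.
  assert (Hgap := crossings_coincide x1 y1 x2 y2 T1 T2 C1 C2).
  destruct (cycle_shape _ _ _ _ _ _ _ H C1) as [Hcl _].
  destruct (extremal_crossings x2 y2 T2 C2) as [s2 [_ [Hxs2 [Hys2 _]]]].
  destruct (left_turn_back x2 y2 T2 s2 C2 Hxs2 Hys2) as [m2 [Hxm2 [Hym2 [_ L2]]]].
  destruct (right_turn_back x2 y2 T2 m2 C2 Hxm2 Hym2) as [p2 [Hxp2 [Hyp2 [_ R2]]]].
  assert (Hdown : forall m1, x1 m1 = 0 -> y1 m1 < 0 -> ln (- y1 m1) - ln (- y2 m2) = 0).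
  { intros m1 Hxm1 Hym1.
    destruct (right_turn_back x1 y1 T1 m1 C1 Hxm1 Hym1) as [p1 [Hxp1 [Hyp1 [_ R1]]]].
    destruct (half_turn_contracts _ _ _ _ _ _ _ _ _ _ _ _ (half_strip_right a b f g H Hcl) R1 R2)
      as [A _].
    assert (E := Hgap p1 p2 Hxp1 Hyp1 Hxp2 Hyp2). unfold gap in E. rewrite E in A. nra. }
  destruct (Rtotal_order (x1 t) 0) as [Hx|[Hx|Hx]].
  - destruct (left_turn_through x1 y1 T1 t C1 Hx) as [s1 [e1 [Ht [Hxs1 [Hys1 L1]]]]].
    destruct (left_turn_contracts _ _ _ _ _ _ _ _ Hcl L1 L2) as [_ [_ A]]. auto.
  - destruct (Rtotal_order (y1 t) 0) as [Hy|[Hy|Hy]].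
    + exists m2. split; [lra|]. assert (A := Hdown t Hx Hy).
      assert (- y1 t = - y2 m2); [|lra]. apply ln_inv; lra.
    + now elim (cycle_section x1 y1 T1 t C1 Hx).
    + exists s2. split; [lra|]. assert (A := Hgap t s2 Hx Hy Hxs2 Hys2).
      unfold gap in A. apply ln_inv; lra.
  - destruct (right_turn_through x1 y1 T1 t C1 Hx) as [s1 [e1 [Ht [Hxs1 [Hys1 R1]]]]].
    destruct (half_turn_contracts _ _ _ _ _ _ _ _ _ _ _ _ (half_strip_right a b f g H Hcl) R1 R2)
      as [_ [_ A]].
    apply A; [|exact Ht]. now apply Hgap.
Qed.

End Turns.

Lemma fg'G_opp (f g : R -> R) (x : R) : fg'G (fun z => - f z) g x = - fg'G f g x.
Proof.
  unfold fg'G. rewrite (Derive_ext _ (fun z => - (f z / g z))).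
  - rewrite Derive_opp. ring.
  - intros t. unfold Rdiv. ring.
Qed.

Lemma phi_opp (f g : R -> R) (x : R) : phi (fun z => - f z) g x = - phi f g x.
Proof.
  unfold phi, extend_at_0. destruct (Req_EM_T x 0).
  - rewrite (Lim_ext (fun z => - fg'G f g z)) by (intros z; symmetry; apply fg'G_opp).
    rewrite Lim_opp, Rbar_opp_real. ring.
  - rewrite fg'G_opp. ring.
Qed.

Lemma cycle_reverse (a b : Rbar) (f g x y : R -> R) (T : R) :
  cycle a b f g x y T ->
  cycle a b (fun z => - f z) g (fun t => x (- t)) (fun t => - y (- t)) T.
Proof.
  intros [Hdx Hdy HT Hpx Hpy [t0 Ht0] Hin].
  assert (Hneg : forall h l t, is_derive h (- t) l -> is_derive (fun t => h (- t)) t (- l)).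
  { intros h l t Hd. eapply is_derive_eq.
    - apply (is_derive_comp h (fun t => - t)); [exact Hd|apply is_derive_neg].
    - unfold scal; simpl. unfold mult; simpl. ring. }
  split.
  - intros t. apply Hneg, Hdx.
  - intros t. eapply is_derive_eq.
    + apply (is_derive_opp (fun t => y (- t))), Hneg, Hdy.
    + unfold opp; simpl. ring.
  - exact HT.
  - intros t. rewrite <- (Hpx (- (t + T))). f_equal. ring.
  - intros t. rewrite <- (Hpy (- (t + T))). do 2 f_equal. ring.
  - exists (- t0). rewrite Ropp_involutive, Ropp_0. intros [E1 E2]. apply Ht0. lra.
  - intros t. apply Hin.
Qed.

Lemma cycle_unique (a b : Rbar) (f g x1 y1 x2 y2 : R -> R) (T1 T2 t : R) :
  admissible a b f g \/ admissible a b (fun z => - f z) g ->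
  cycle a b f g x1 y1 T1 -> cycle a b f g x2 y2 T2 ->
  exists t', x1 t = x2 t' /\ y1 t = y2 t'.
Proof.
  intros [H|H] C1 C2; [now apply (cycle_included a b f g H x1 y1 x2 y2 T1 T2)|].
  destruct (cycle_included _ _ _ _ H _ _ _ _ _ _ (- t) (cycle_reverse _ _ _ _ _ _ _ C1)
    (cycle_reverse _ _ _ _ _ _ _ C2)) as [t' [E1 E2]].
  rewrite Ropp_involutive in E1, E2. exists (- t'). split; lra.
Qed.

Lemma cycle_hyperbolic (a b : Rbar) (f g x y : R -> R) (T : R) :
  (forall z, Rbar_interval a b z -> ex_derive f z) ->
  admissible a b f g \/ admissible a b (fun z => - f z) g ->
  cycle a b f g x y T -> RInt (fun t => - f (x t)) 0 T <> 0.
Proof.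
  intros Hf H C.
  assert (Hex : forall p q, ex_RInt (fun t => f (x t)) p q).
  { intros p q. apply (ex_RInt_continuous (fun t => f (x t))). intros t _.
    now apply (continuous_along_cycle a b f g x y T). }
  assert (Hopp : RInt (fun t => - f (x t)) 0 T = - RInt (fun t => f (x t)) 0 T)
    by (apply (RInt_opp (fun t => f (x t))), Hex).
  rewrite Hopp. destruct H as [H|H].
  - assert (A := hyperbolic_cycle _ _ _ _ _ _ _ 0 H C). rewrite Rplus_0_l in A. lra.
  - assert (A := hyperbolic_cycle _ _ _ _ _ _ _ (- T) H (cycle_reverse _ _ _ _ _ _ _ C)).
    rewrite Rplus_opp_l in A. intros E. apply A.
    assert (R := RInt_comp_lin (fun t => f (x t)) (-1) 0 (- T) 0 (Hex _ _)).
    replace (-1 * - T + 0) with T in R by ring. replace (-1 * 0 + 0) with 0 in R by ring.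
    rewrite <- (opp_RInt_swap (fun t => f (x t))) in R by apply Hex.
    eapply eq_trans; [|eapply eq_trans; [exact R|exact E]].
    apply RInt_ext. intros t _. replace (-1 * t + 0) with (- t) by ring.
    unfold scal; simpl. unfold mult; simpl. ring.
Qed.

Lemma cycle_of_parametrization (a b : Rbar) (f g : R -> R) (Gamma : R * R -> Prop)
    (gamma : R -> R * R) (T : R) :
  periodic_parametrization (lienard f g) Gamma gamma T ->
  (forall p, Gamma p -> strip a b p) ->
  cycle a b f g (fun t => fst (gamma t)) (fun t => snd (gamma t)) T.
Proof.
  intros [Hs [HT [Hp [[t0 Ht0] HG]]]] Hin. split.
  - intros t. apply (Hs t).
  - intros t. apply (Hs t).
  - exact HT.
  - intros t. now rewrite Hp.
  - intros t. now rewrite Hp.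
  - exists t0. intros [E1 E2]. apply Ht0. now apply injective_projections.
  - intros t. apply (Hin (gamma t)). apply HG. now exists t.
Qed.

Lemma divergence_lienard (f g : R -> R) (p : R * R) :
  divergence (lienard f g) p = - f (fst p).
Proof.
  unfold divergence, lienard; simpl. rewrite Derive_const.
  rewrite (is_derive_unique _ _ (- f (fst p))); [ring|].
  auto_derive; auto; ring.
Qed.

Lemma open_strip (a b : Rbar) : open (strip a b).
Proof.
  unfold strip. apply (open_comp fst (Rbar_interval a b)).
  - intros p _. apply continuous_fst.
  - apply (open_and _ _ (open_Rbar_gt a) (open_Rbar_lt b)).
Qed.

Theorem proposition5 (a b : Rbar) (f g : R -> R)
    (ha : Rbar_lt a 0) (hb : Rbar_lt 0 b)
    (hf : C1_on (Rbar_interval a b) f)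
    (hg : C1_on (Rbar_interval a b) g)
    (hg0 : forall x : R, Rbar_interval a b x -> (g x = 0 <-> x = 0))
    (hGg : ex_finite_lim (G_over_g g) 0)
    (hfgG : ex_finite_lim (fg'G f g) 0)
    (hsign :
      (forall x : R, Rbar_interval a b x ->
         0 <= f x + 2 * extend_at_0 (fg'G f g) x) \/
      (forall x : R, Rbar_interval a b x ->
         f x + 2 * extend_at_0 (fg'G f g) x <= 0))
    (hzero : forall x : R, Rbar_interval a b x ->
       f x + 2 * extend_at_0 (fg'G f g) x = 0 -> x = 0) :
  (forall Gamma1 Gamma2 : R * R -> Prop,
     periodic_orbit (lienard f g) Gamma1 ->
     (forall p, Gamma1 p -> strip a b p) ->
     periodic_orbit (lienard f g) Gamma2 ->
     (forall p, Gamma2 p -> strip a b p) ->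
     forall p, Gamma1 p <-> Gamma2 p) /\
  (forall Gamma : R * R -> Prop,
     periodic_orbit (lienard f g) Gamma ->
     (forall p, Gamma p -> strip a b p) ->
     limit_cycle (lienard f g) Gamma /\ hyperbolic (lienard f g) Gamma).
Proof.
  assert (Hadm : admissible a b f g \/ admissible a b (fun z => - f z) g).
  { destruct hsign as [Hs|Hs]; [left|right]; split;
      try (intros x Hx; apply hg, Hx); auto; try (now split).
    - intros x Hx. now apply hf.
    - intros x Hx Hn. destruct (Hs x Hx) as [A|A]; [exact A|].
      symmetry in A. now apply hzero in A.
    - intros x Hx. apply (ex_derive_opp f). now apply hf.
    - destruct hfgG as [l Hl]. exists (- l).
      apply (is_lim_ext (fun z => - fg'G f g z)); [intros z; symmetry; apply fg'G_opp|].
      apply (is_lim_opp _ _ _ Hl).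
    - intros x Hx. rewrite phi_opp. specialize (Hs x Hx). unfold phi. lra.
    - intros x Hx Hn. rewrite phi_opp. unfold phi. destruct (Hs x Hx) as [A|A]; [lra|].
      now apply hzero in A. }
  assert (Huniq : forall Gamma1 Gamma2 : R * R -> Prop,
     periodic_orbit (lienard f g) Gamma1 -> (forall p, Gamma1 p -> strip a b p) ->
     periodic_orbit (lienard f g) Gamma2 -> (forall p, Gamma2 p -> strip a b p) ->
     forall p, Gamma1 p -> Gamma2 p).
  { intros Gamma1 Gamma2 [g1 [T1 P1]] I1 [g2 [T2 P2]] I2 p Hp.
    assert (C1 := cycle_of_parametrization a b f g Gamma1 g1 T1 P1 I1).
    assert (C2 := cycle_of_parametrization a b f g Gamma2 g2 T2 P2 I2).
    destruct P1 as [_ [_ [_ [_ G1]]]]. destruct P2 as [_ [_ [_ [_ G2]]]].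
    apply G1 in Hp. destruct Hp as [t <-].
    destruct (cycle_unique a b f g _ _ _ _ T1 T2 t Hadm C1 C2) as [t' [E1 E2]].
    apply G2. exists t'. symmetry. now apply injective_projections. }
  split.
  - intros Gamma1 Gamma2 O1 I1 O2 I2 p. split; now apply Huniq.
  - intros Gamma O I. split.
    + split; [exact O|]. exists (strip a b). split; [apply open_strip|]. split; [exact I|].
      intros Gamma' O' I' p. split; now apply Huniq.
    + intros gamma T P.
      assert (C := cycle_of_parametrization a b f g Gamma gamma T P I).
      rewrite (RInt_ext _ (fun t => - f (fst (gamma t)))).
      * refine (cycle_hyperbolic a b f g _ _ T _ Hadm C).
        intros z Hz. now apply hf.
      * intros t _. apply divergence_lienard.
Qed.
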